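(* Let $C_1,\ldots,C_m$ be completely invertible $n\times n$ matrices, and let $W(A;C_1,\ldots,C_m)$ be a generalized symmetric word in which every exponent $p_i$ of $A$ is positive. Then the generalized symmetric word equation $$W(A;C_1,\ldots,C_m)=P$$ is solvable for any positive definite $n\times n$ matrix $P$, i.e. there exists a positive definite $n\times n$ matrix $A$ satisfying it.
   Context: All matrices are complex, and positive definite means complex Hermitian positive definite. The field of values of an $n\times n$ matrix $C$ is $F(C)=\{x^*Cx : x^*x=1,\ x\in\mathbb C^n\}$. The matrix $C$ is called completely invertible if $0\notin F(C)$. If $C_1,\ldots,C_m$ is any list of $m$ invertible $n\times n$ matrices and $W(A;C_1,\ldots,C_m)=A^{p_1}C_1A^{p_2}C_2\cdots C_2^*A^{p_2}C_1^*A^{p_1}$ (with real exponents $p_i$) is such that $W(A;C_1,\ldots,C_m)^*=W(A;C_1,\ldots,C_m)$, then $W$ is called a generalized symmetric word. For a given positive definite matrix $P$ and given invertible $C_1,\ldots,C_m$, the equation $W(A;C_1,\ldots,C_m)=P$ with each $p_i>0$ is called a generalized symmetric word equation in the positive definite variable $A$. Real powers of positive definite matrices are the primary ones: if $A=UDU^*$ with $U$ unitary and $D$ diagonal with positive diagonal entries, then $A^p=UD^pU^*$.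
   Formalization: When the middle of the word is a single unpaired matrix C_m (not a power of A), C_m is assumed not to be negative definite; otherwise the claim fails, e.g. m = 1, C_1 = -I gives W(A) = -A^{2p_1}, which is never positive definite. *)

(* Defs.v *)
From mathcomp Require Import all_boot all_order all_algebra.
From mathcomp Require Import sesquilinear spectral.
From mathcomp Require Import complex.
From mathcomp Require Import boolp classical_sets reals exp.

Set Implicit Arguments.
Unset Strict Implicit.
Unset Printing Implicit Defensive.

Import Order.TTheory GRing.Theory Num.Theory.

Local Open Scope ring_scope.
Local Open Scope complex_scope.
Local Open Scope classical_set_scope.
Local Open Scope sesquilinear_scope.

Section Definitions.
Variables (R : realType) (n : nat).
Implicit Types (A B C U : 'M[R[i]]_n) (p : seq R) (Cs : seq 'M[R[i]]_n).

Definition field_of_values C : set R[i] :=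
  [set z | exists x : 'cV[R[i]]_n,
     x^t* *m x = 1%:M /\ z = (x^t* *m C *m x) ord0 ord0].

Definition completely_invertible C : Prop := ~ field_of_values C 0.

(* [0 < z] in [R[i]] means that z is real and positive. *)
Definition posdef A : Prop :=
  A^t* = A /\
  forall x : 'cV[R[i]]_n, x != 0 -> 0 < (x^t* *m A *m x) ord0 ord0.

(* [spectralmx A] is unitary and, for A normal,
   A = (spectralmx A)^t* *m diag_mx (spectral_diag A) *m spectralmx A;
   [mxpowE] below shows that any other unitary diagonalisation of A gives the
   same power. *)
Definition mxpow A (r : R) : 'M[R[i]]_n :=
  (spectralmx A)^t*
    *m diag_mx (map_mx (fun z => (powR (complex.Re z) r)%:C) (spectral_diag A))
    *m spectralmx A.

(* With p = [:: p_1; ...] and Cs = [:: C_1; ...; C_m], the words are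
   - for size p = m + 1, with a power of A in the middle:
     A^p_1 C_1 ... A^p_m C_m A^p_(m+1) C_m^* A^p_m ... C_1^* A^p_1;
   - for size p = m, with a matrix in the middle:
     A^p_1 C_1 ... C_(m-1) A^p_m C_m A^p_m C_(m-1)^* ... C_1^* A^p_1.
   Other sizes are ruled out by [generalized_symmetric_word]. *)
Fixpoint gsword p Cs A : 'M[R[i]]_n :=
  match p, Cs with
  | [:: q], [::] => mxpow A q
  | [:: q], [:: C] => mxpow A q *m C *m mxpow A q
  | q :: p', C :: Cs' =>
      mxpow A q *m C *m gsword p' Cs' A *m C^t* *m mxpow A q
  | _, _ => 1%:M
  end.

Definition generalized_symmetric_word p Cs : Prop :=
  [/\ size p = (size Cs).+1 \/ (size p = size Cs /\ (0 < size Cs)%N),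
      forall C, C \in Cs -> C \in unitmx
    & forall A, posdef A -> (gsword p Cs A)^t* = gsword p Cs A].

Lemma adjmxM (k l m : nat) (M : 'M[R[i]]_(k, l)) (N : 'M[R[i]]_(l, m)) :
  (M *m N)^t* = N^t* *m M^t*.
Proof. by rewrite trmx_mul map_mxM. Qed.

Lemma adjmxK (k l : nat) (M : 'M[R[i]]_(k, l)) : (M^t*)^t* = M.
Proof. by apply/matrixP => i j; rewrite !mxE conjCK. Qed.

Lemma mxpowE U (d : 'rV[R]_n) (r : R) :
  U \is unitarymx ->
  mxpow (U *m diag_mx (map_mx (real_complex R) d) *m U^t*) r =
  U *m diag_mx (map_mx (fun x => (powR x r)%:C) d) *m U^t*.
Proof.
move=> Uu; set A := U *m _ *m _.
have UU : U *m U^t* = 1%:M by apply/unitarymxP.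
have U'U : U^t* *m U = 1%:M by apply: mulmx1C.
have diag_adj (e : 'rV[R]_n) :
    (diag_mx (map_mx (real_complex R) e))^t* = diag_mx (map_mx (real_complex R) e).
  apply/matrixP => i j; rewrite !mxE [j == i]eq_sym.
  case: eqP => [->|_]; last by rewrite !mulr0n rmorph0.
  by rewrite !mulr1n; apply/eqP; rewrite eq_complex /= oppr0 !eqxx.
have Aherm : A^t* = A by rewrite /A !adjmxM adjmxK diag_adj mulmxA.
have /orthomx_spectralP A_eq : A \is normalmx by apply/normalmxP; rewrite Aherm.
have Vu := spectral_unitarymx A.
rewrite invmx_unitary // in A_eq.
rewrite /mxpow; set V := spectralmx A in A_eq Vu *; set e := spectral_diag A in A_eq *.
have VV : V *m V^t* = 1%:M by apply/unitarymxP.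
have V'V : V^t* *m V = 1%:M by apply: mulmx1C.
set X := V *m U.
have inter : diag_mx e *m X = X *m diag_mx (map_mx (real_complex R) d).
  have -> : diag_mx e = V *m A *m V^t*.
    by rewrite {1}A_eq !mulmxA VV mul1mx -mulmxA VV mulmx1.
  rewrite /X /A -!mulmxA [V^t* *m (V *m U)]mulmxA V'V mul1mx.
  by rewrite U'U mulmx1.
have interp : diag_mx (map_mx (fun z => (powR (complex.Re z) r)%:C) e) *m X
            = X *m diag_mx (map_mx (fun x => (powR x r)%:C) d).
  apply/matrixP => i j; have /matrixP/(_ i j) := inter.
  rewrite !mul_diag_mx !mul_mx_diag !mxE [in RHS]mulrC => eX.
  case: (eqVneq (X i j) 0) => [X0|X0].
    by move: X0; rewrite mxE => ->; rewrite !(mulr0, mul0r).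
  have -> : e 0 i = (d 0 j)%:C.
    by apply: (mulIf X0); rewrite mxE eX.
  by rewrite mulrC.
have UVX : U = V^t* *m X by rewrite /X mulmxA V'V mul1mx.
rewrite {1}UVX -[V^t* *m X *m _]mulmxA -interp /X.
by rewrite -!mulmxA UU mulmx1.
Qed.

Lemma mxpow_adj A r : (mxpow A r)^t* = mxpow A r.
Proof.
rewrite /mxpow !adjmxM adjmxK mulmxA; congr (_ *m _ *m _).
apply/matrixP => i j; rewrite !mxE [j == i]eq_sym.
case: eqP => [->|_]; last by rewrite !mulr0n rmorph0.
by rewrite !mulr1n; apply/eqP; rewrite eq_complex /= oppr0 !eqxx.
Qed.

Lemma gsword_adj p Cs A :
  size p = (size Cs).+1 -> (gsword p Cs A)^t* = gsword p Cs A.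
Proof.
elim: Cs p => [|C Cs IH] [|q [|q' p]] // sz; first exact: mxpow_adj.
have {}IH := IH (q' :: p) (eq_add_S _ _ sz).
have -> : gsword [:: q, q' & p] (C :: Cs) A =
  mxpow A q *m C *m gsword (q' :: p) Cs A *m C^t* *m mxpow A q by [].
move: (gsword _ _ _) IH (mxpow A q) (mxpow_adj A q) => Y Yadj X Xadj.
by rewrite !adjmxM adjmxK Xadj Yadj !mulmxA.
Qed.

End Definitions.

(* Main.v *)
(* Write W(B) for the word and let clamp(H) be the spectral truncation of a
   Hermitian H to the order interval [0, 1].  Brouwer's theorem, applied to
     H |-> B - s (W(B) - tau P)  with  B = clamp(H),
   gives H - B = s (tau P - W(B)) for small s and tau.  Since B and H are
   diagonal in a common eigenbasis, tr(B (H - B)) >= 0, so tr(B W(B)) <= tau tr(B P).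
   Complete invertibility makes x^* W(B) x > 0 whenever B x <> 0; by compactness
   tr(B W(B)) is bounded below once B has an eigenvalue 1, so for small tau all
   eigenvalues of H are < 1.  At an eigenvector x of H with eigenvalue <= 0 one
   has B x = 0, hence W(B) x = 0 and x^* (H - B) x = s tau x^* P x > 0, which is
   absurd.  So 0 < H < 1, B = H and W(B) = tau P, and homogeneity of W removes tau.
   Brouwer's theorem itself comes from Kuhn's cubical version of Sperner's lemma. *)
Require Import Defs.
From mathcomp Require Import all_boot all_order all_algebra.
From mathcomp Require Import complex reals.
From mathcomp Require Import sesquilinear spectral.
From mathcomp Require Import boolp classical_sets topology normedtype derive exp.
From mathcomp Require Import zify ring lra.

Set Implicit Arguments.
Unset Strict Implicit.
Unset Printing Implicit Defensive.

Import Order.TTheory GRing.Theory Num.Theory numFieldNormedType.Exports.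

(** * Kuhn's lemma *)

(** The positive definite matrices form a set that is neither closed nor bounded, so Brouwer's
    theorem does not apply to it directly. The unknown therefore ranges over a box of Hermitian
    matrices, described by [n * n] real coordinates, and only its truncation enters the word.
    Truncation produces singular matrices; the powers extend continuously to them because the
    exponents are positive. Continuity of the powers cannot be read off a diagonalisation, since
    eigenvectors need not depend continuously on the matrix. Instead two matrices are compared in
    their two eigenbases at once: the squared Frobenius distance becomes a sum over pairs of
    eigenvalues with weights that do not change when a function is applied to both matrices. *)

Lemma involution_even_size (T : eqType) (f : T -> T) (D : seq T) :
  uniq D -> (forall x, x \in D -> [/\ f x \in D, f (f x) = x & f x != x]) ->
  ~~ odd (size D).
Proof.
have [n] := ubnP (size D); elim: n D => // n IHn [|x D] // /ltnSE szD uD fD.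
have [fxD ffx fxx] := fD x (mem_head _ _).
have fx_D : f x \in D by move: fxD; rewrite inE (negbTE fxx).
have szr := size_rem fx_D.
have D_gt0 : 0 < size D by case: (D) fx_D.
have /andP[xD uD'] := uD.
have /IHn : size (rem (f x) D) < n by move: szD; rewrite szr /=; lia.
rewrite szr /= => IH; suff : ~~ odd (size D).-1 by lia.
apply: IH => [|y]; first exact: rem_uniq.
rewrite (mem_rem_uniq _ uD') inE => /andP[yfx yD].
have [fyD ffy fyy] := fD y (@mem_behead _ (x :: D) _ yD).
have yx : y != x by apply: contraNneq xD => <-.
split=> //; rewrite (mem_rem_uniq _ uD') inE.
have -> : f y != f x by apply: contra_neq yx => e; rewrite -ffy e.
move: fyD; rewrite inE => /orP[/eqP fyx|//].
by rewrite -fyx ffy eqxx in yfx.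
Qed.

Section Kuhn.
Variables (N p : nat).
Hypothesis p_gt0 : 0 < p.
Variable lbl : {ffun 'I_N -> nat} -> nat.
Hypothesis lbl_leN : forall v, lbl v <= N.
Hypothesis lbl_neq0 : forall (v : {ffun 'I_N -> nat}) i, v i = 0 -> lbl v != i.
Hypothesis lbl_leqp : forall (v : {ffun 'I_N -> nat}) i, v i = p -> lbl v <= i.

Local Notation point := {ffun 'I_N -> 'I_p.+1}.
Implicit Types (x : point) (s : seq nat).

(* A pair (x, s) with s a permutation of 0, ..., k-1 encodes the simplex of
   Kuhn's triangulation with vertices vtx x s 0, ..., vtx x s k, each obtained
   from the previous one by a unit step in the direction given by s. *)
Definition vtx x s j : {ffun 'I_N -> nat} :=
  [ffun i : 'I_N => x i + (val i \in take j s)].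

(* The k-simplices live in the face where all coordinates of index >= k are p. *)
Definition okx k x := [forall i : 'I_N, if i < k then x i < p else x i == p :> nat].

Definition simplices k : seq (point * seq nat) :=
  [seq (x, s) | x <- [seq x <- enum point | okx k x], s <- permutations (iota 0 k)].

Definition vlbl x s j := lbl (vtx x s j).

Definition full k (e : point * seq nat) :=
  perm_eq [seq vlbl e.1 e.2 j | j <- iota 0 k.+1] (iota 0 k.+1).

Definition door k (e : point * seq nat) j :=
  perm_eq [seq vlbl e.1 e.2 i | i <- iota 0 k.+2 & i != j] (iota 0 k.+1).

Lemma mem_simplices k e :
  (e \in simplices k) = okx k e.1 && perm_eq e.2 (iota 0 k).
Proof.
case: e => x s; apply/allpairsP/andP => [[[x' s'] /= [h1 h2 [-> ->]]]|/= [h1 h2]].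
  by move: h1 h2; rewrite mem_filter mem_permutations => /andP[-> _] ->.
by exists (x, s); rewrite mem_filter mem_permutations h1 h2 mem_enum.
Qed.

Lemma simplices_uniq k : uniq (simplices k).
Proof.
apply: allpairs_uniq; first by rewrite filter_uniq // enum_uniq.
  exact: permutations_uniq.
by move=> [x s] [x' s'] _ _ /= [-> ->].
Qed.

Lemma okx_lt k x (i : 'I_N) : okx k x -> i < k -> x i < p.
Proof. by move/forallP/(_ i); case: ifP. Qed.

Lemma okx_ge k x (i : 'I_N) : okx k x -> k <= i -> x i = p :> nat.
Proof. by move/forallP/(_ i); rewrite ltnNge => h ki; move: h; rewrite ki => /eqP. Qed.

(** Coordinate [k] equals [p] on the face that carries the [k]-simplices, so [lbl_leqp] caps their
    labels at [k]; for [k = N] the cap is [lbl_leN]. *)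
Lemma vlbl_le k x s j : k <= N -> okx k x -> perm_eq s (iota 0 k) -> vlbl x s j <= k.
Proof.
rewrite leq_eqVlt => /orP[/eqP -> _ _|kN okxx ps]; first exact: lbl_leN.
rewrite -[k in _ <= k]/(val (Ordinal kN)); apply: lbl_leqp.
rewrite ffunE (okx_ge okxx) //=.
suff /negbTE -> : k \notin take j s by rewrite addn0.
by apply/negP => /mem_take; rewrite (perm_mem ps) mem_iota; lia.
Qed.

Lemma perm_rest k (w : nat -> nat) j : j < k ->
  perm_eq [seq w i | i <- iota 0 k] (w j :: [seq w i | i <- iota 0 k & i != j]).
Proof.
move=> jk; rewrite -[w j :: _]/[seq w i | i <- j :: [seq i <- iota 0 k | i != j]].
apply: perm_map; rewrite -rem_filter ?iota_uniq //.
by rewrite perm_to_rem // mem_iota.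
Qed.

(** A full simplex has one door, opposite its vertex labelled [k.+1]. Any other simplex with a door
    repeats one of the labels [0, ..., k], and has exactly two doors, opposite the two vertices that
    share this label. *)
Lemma odd_doors k e : k.+1 <= N -> e \in simplices k.+1 ->
  odd (count (door k e) (iota 0 k.+2)) = full k.+1 e.
Proof.
case: e => x s kN; rewrite mem_simplices => /andP[okxx ps]; rewrite /fst /snd in okxx ps.
pose w := vlbl x s.
have w_le j : w j <= k.+1 by exact: vlbl_le.
have doorE j : j < k.+2 ->
    door k (x, s) j = perm_eq [seq w i | i <- iota 0 k.+2] (w j :: iota 0 k.+1).
  move=> jk; rewrite (permPl (perm_rest w jk)) perm_cons.
  by [].
have iotaS : perm_eq (iota 0 k.+2) (k.+1 :: iota 0 k.+1).
  by rewrite -[k.+2]addn1 iotaD perm_catC.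
case: (boolP (has (door k (x, s)) (iota 0 k.+2))) => [/hasP[j0 j0k dj0]|nodoor].
  have j0lt : j0 < k.+2 by move: j0k; rewrite mem_iota.
  have pw := dj0; rewrite doorE // in pw.
  have -> : count (door k (x, s)) (iota 0 k.+2)
            = count_mem (w j0) [seq w i | i <- iota 0 k.+2].
    rewrite count_map; apply: eq_in_count => j; rewrite mem_iota => /= jk.
    rewrite doorE // (permPl pw); apply/idP/eqP => [pe|-> //].
    (* The two lists share their tail, so comparing sums identifies their heads. *)
    have := perm_sumn pe; rewrite /= => /eqP.
    by rewrite eqn_add2r => /eqP ->.
  have -> : full k.+1 (x, s) = (w j0 == k.+1).
    rewrite /full /= (permPl pw) (permPr iotaS).
    apply/idP/eqP => [pe|-> //].
    have := perm_sumn pe; rewrite /= => /eqP.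
    by rewrite eqn_add2r => /eqP ->.
  rewrite (permP pw) /= eqxx.
  rewrite -/(count_mem (w j0) (0 :: iota 1 k)) -/(iota 0 k.+1).
  rewrite count_uniq_mem ?iota_uniq // mem_iota.
  by have := w_le j0; lia.
have /eqP : count (door k (x, s)) (iota 0 k.+2) = 0.
  by apply/eqP; rewrite -leqn0 leqNgt -has_count.
move=> /eqP ->; apply/esym/negbTE; apply: contra nodoor => fl.
have : k.+1 \in [seq w i | i <- iota 0 k.+2].
  by rewrite (perm_mem fl) mem_iota; lia.
case/mapP => j jk wj; apply/hasP; exists j => //.
rewrite doorE; last by move: jk; rewrite mem_iota.
by rewrite -wj -(permPr iotaS).
Qed.

(** * Adjacent simplices and the doors between them *)

Definition up (a : nat) x : point :=
  [ffun i => if val i == a then inord (x i).+1 else x i].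
Definition down (a : nat) x : point :=
  [ffun i => if val i == a then inord (x i).-1 else x i].
(** Two consecutive directions trade places, so that only the [j]-th vertex of the path moves. *)
Definition swap (j : nat) s :=
  take j.-1 s ++ nth 0 s j :: nth 0 s j.-1 :: drop j.+1 s.

Definition coord x (a : nat) : nat := if insub a is Some i then x i else 0.

(* The other simplex sharing the facet opposite to the j-th vertex. *)
Definition pivot k (t : point * seq nat * nat) : point * seq nat * nat :=
  let: (x, s, j) := t in
  if j == 0 then (up (head 0 s) x, rot 1 s, k)
  else if j == k then (down (last 0 s) x, rotr 1 s, 0)
  else (x, swap j s, j).

(* The facet opposite to the j-th vertex lies on the boundary of the cube. *)
Definition bdry k (t : point * seq nat * nat) :=
  let: (x, s, j) := t in
  ((j == 0) && (coord x (head 0 s) == p.-1)) || ((j == k) && (coord x (last 0 s) == 0)).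

Definition doors k : seq (point * seq nat * nat) :=
  [seq t <- [seq (e, j) | e <- simplices k.+1, j <- iota 0 k.+2] | door k t.1 t.2].

Lemma mem_doors k t : (t \in doors k) =
  [&& okx k.+1 t.1.1, perm_eq t.1.2 (iota 0 k.+1), t.2 < k.+2 & door k t.1 t.2].
Proof.
case: t => [e j]; rewrite mem_filter andbC [t in door _ t]/= !andbA; congr andb.
apply/allpairsP/andP => [[[e' j'] [h1 h2 [-> ->]]]|[h1 h2]].
  by move: h1 h2; rewrite mem_simplices mem_iota.
by exists (e, j); rewrite mem_iota mem_simplices h1 h2.
Qed.

Lemma doors_uniq k : uniq (doors k).
Proof.
rewrite filter_uniq // allpairs_uniq //; [exact: simplices_uniq|exact: iota_uniq|].
by move=> [x s] [x' s'] _ _ /= [-> ->].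
Qed.

Lemma odd_size_doors k : k.+1 <= N ->
  odd (size (doors k)) = odd (count (full k.+1) (simplices k.+1)).
Proof.
move=> kN; rewrite size_filter.
have : forall e, e \in simplices k.+1 -> e \in simplices k.+1 by [].
elim: {-2}(simplices k.+1) => // e S IH sub.
rewrite allpairs_cons count_cat oddD IH; last by move=> e' e'S; apply: sub; rewrite inE e'S orbT.
rewrite count_map [in RHS]/= oddD oddb; congr addb.
by rewrite -(odd_doors kN (sub e (mem_head _ _))).
Qed.


Lemma filter_iota0 k : [seq i <- iota 0 k.+1 | i != 0] = iota 1 k.
Proof.
by rewrite /=; apply/all_filterP/allP => i; rewrite mem_iota; lia.
Qed.

Lemma filter_iota_last k : [seq i <- iota 0 k.+1 | i != k] = iota 0 k.
Proof.
rewrite -[k.+1]addn1 iotaD filter_cat /= eqxx cats0.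
by apply/all_filterP/allP => i; rewrite mem_iota; lia.
Qed.

Lemma vtx_up a s x m (i : 'I_N) : val i = a -> x i < p -> a \notin s -> m <= size s ->
  vtx (up a x) (rcons s a) m = vtx x (a :: s) m.+1.
Proof.
move=> ia xip als ms; apply/ffunP => j; rewrite !ffunE -cats1 takel_cat //= inE.
case: (eqVneq (val j) a) => [ja|//].
have ji : j = i by apply: val_inj; rewrite /= ja ia.
rewrite inordK; last by rewrite ji; lia.
have /negbTE -> : val j \notin take m s by apply: contra als => /mem_take; rewrite ja.
by lia.
Qed.

Lemma door_up k a s x (i : 'I_N) : val i = a -> x i < p -> a \notin s -> size s = k ->
  door k (up a x, rcons s a) k.+1 = door k (x, a :: s) 0.
Proof.
move=> ia xip als sk; rewrite /door filter_iota0 filter_iota_last; congr perm_eq.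
rewrite -[1]addn0 iotaDl -map_comp; apply/eq_in_map => m; rewrite mem_iota => /= mk.
by rewrite /vlbl (vtx_up ia) // sk; lia.
Qed.

Lemma upK a x (i : 'I_N) : val i = a -> x i < p -> down a (up a x) = x.
Proof.
move=> ia xip; apply/ffunP => j; rewrite !ffunE; case: (eqVneq (val j) a) => [ja|//].
have ji : j = i by apply: val_inj; rewrite /= ja ia.
by apply/val_inj; rewrite ji /= !inordK ?inordK //; lia.
Qed.

Lemma downK a x (i : 'I_N) : val i = a -> 0 < x i -> up a (down a x) = x.
Proof.
move=> ia xip; apply/ffunP => j; rewrite !ffunE; case: (eqVneq (val j) a) => [ja|//].
have ji : j = i by apply: val_inj; rewrite /= ja ia.
have xip1 := ltn_ord (x i); apply/val_inj; rewrite ji /= !inordK ?inordK //; lia.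
Qed.

Lemma coordE x (i : 'I_N) : coord x i = x i.
Proof. by rewrite /coord valK. Qed.

Lemma okx_up k x (i : 'I_N) : i < k -> (x i).+1 < p -> okx k x -> okx k (up i x).
Proof.
move=> ik xip /forallP okxx; apply/forallP => j; have := okxx j; rewrite ffunE.
case: (eqVneq (val j) (val i)) => [ji|//].
have -> : j = i by exact: val_inj.
by rewrite ik inordK //; lia.
Qed.

Lemma okx_down k x (i : 'I_N) : i < k -> okx k x -> okx k (down i x).
Proof.
move=> ik /forallP okxx; apply/forallP => j; have := okxx j; rewrite ffunE.
case: (eqVneq (val j) (val i)) => [ji|//].
have -> : j = i by exact: val_inj.
by rewrite ik => h; rewrite inordK //; lia.
Qed.

Lemma pivot_mid k x s j : 0 < j < k.+1 -> perm_eq s (iota 0 k.+1) ->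
  exists s1 a b s2, [/\ s = s1 ++ a :: b :: s2, size s1 = j.-1 &
    swap j s = s1 ++ b :: a :: s2].
Proof.
move=> /andP[j0 jk] ps; have szs : size s = k.+1 by rewrite (perm_size ps) size_iota.
exists (take j.-1 s), (nth 0 s j.-1), (nth 0 s j), (drop j.+1 s); split=> //.
  rewrite -{1}(cat_take_drop j.-1 s) (drop_nth 0) ?szs; last by lia.
  by rewrite prednK // (drop_nth 0) // szs.
by rewrite size_takel // szs; lia.
Qed.

(** Moving the initial vertex past the end of the path, or the last one before its start, keeps all
    the others; exchanging two consecutive directions replaces one inner vertex. Off the boundary
    this is an involution without fixed points, so the interior doors are even in number. *)
Lemma pivotP k t : k.+1 <= N -> t \in doors k -> ~~ bdry k.+1 t ->
  [/\ pivot k.+1 t \in doors k, ~~ bdry k.+1 (pivot k.+1 t),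
      pivot k.+1 (pivot k.+1 t) = t & pivot k.+1 t != t].
Proof.
case: t => [[x s] j] kN; rewrite mem_doors => /and4P[]; rewrite /fst /snd.
move=> okxx ps jk dj; have szs : size s = k.+1 by rewrite (perm_size ps) size_iota.
have us : uniq s by rewrite (perm_uniq ps) iota_uniq.
have sk a : a \in s -> a < k.+1 by rewrite (perm_mem ps) mem_iota.
rewrite /bdry /pivot; case: (eqVneq j 0) => [j0|j_neq0].
  subst j; case: s ps szs us sk dj => [//|a s] ps [szs] /andP[als us] sk dj.
  have aN : a < N by apply: leq_trans kN; apply: sk; rewrite mem_head.
  have [i ia] : exists i : 'I_N, a = val i by exists (Ordinal aN).
  rewrite ia in als ps dj sk * => {a aN ia}.
  have ak : i < k.+1 by apply: sk; rewrite mem_head.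
  have xip := okx_lt okxx ak.
  rewrite /= !coordE rot1_cons => /norP[xi _]; split=> //.
  - rewrite mem_doors /= okx_up //; last by lia.
    by rewrite (door_up (i := i)) // perm_rcons ps dj ltnSn.
  - by rewrite eqxx last_rcons coordE ffunE eqxx inordK //; lia.
  - by rewrite eqxx last_rcons (upK (i := i)) // -rot1_cons rotK.
  by apply/eqP => -[].
case: (eqVneq j k.+1) => [jk1|j_neqk].
  subst j; case/lastP: s ps szs us sk dj => [//|s a] ps szs us sk dj.
  rewrite size_rcons in szs; case: szs => szs; rewrite rcons_uniq in us.
  have {us} [als us] := andP us.
  have aN : a < N by apply: leq_trans kN; apply: sk; rewrite mem_rcons mem_head.
  have [i ia] : exists i : 'I_N, a = val i by exists (Ordinal aN).
  rewrite ia in als ps dj sk * => {a aN ia}.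
  have ak : i < k.+1 by apply: sk; rewrite mem_rcons mem_head.
  have xip := okx_lt okxx ak.
  rewrite eqxx last_rcons /= coordE rotr1_rcons => xi.
  have dxi : down i x i = (x i).-1 :> nat by rewrite ffunE eqxx inordK //; lia.
  split=> //.
  - rewrite mem_doors /= okx_down // -(door_up (i := i)) // ?dxi;
      last exact: leq_ltn_trans (leq_pred _) xip.
    by rewrite (downK (i := i)) ?lt0n // -perm_rcons ps dj.
  - rewrite coordE dxi orbF; move: xi xip; case: (nat_of_ord (x i)) => //= y _; lia.
  - by rewrite /= ?(downK (i := i)) ?lt0n // -rotr1_rcons rotrK.
  by apply/eqP => -[].
have jin : 0 < j < k.+1 by lia.
have [s1 [a [b [s2 [es szs1 sw]]]]] := pivot_mid x jin ps.
have perm_sw : perm_eq (swap j s) s.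
  rewrite sw es perm_cat2l -[b :: a :: s2]/([:: b; a] ++ s2) -[a :: b :: s2]/([:: a; b] ++ s2).
  by rewrite perm_cat2r (perm_catC [:: b] [:: a]).
rewrite (negbTE j_neq0) (negbTE j_neqk); split=> //.
- rewrite mem_doors /= okxx jk (perm_trans perm_sw ps) /=.
  have -> : door k (x, swap j s) j = door k (x, s) j => [|//].
  rewrite /door; congr perm_eq; apply/eq_in_map => m.
  rewrite mem_filter mem_iota /= => /andP[mj mk]; rewrite /vlbl; congr lbl.
  apply/ffunP => i; rewrite !ffunE; congr (_ + nat_of_bool _).
  rewrite sw es !take_cat szs1; case: ltnP => // jm.
  (* As [m] differs from [j], the first [m] directions contain both exchanged ones or neither. *)
  have : m - j.-1 = 0 \/ exists m', m - j.-1 = m'.+2.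
    case: (m - j.-1) (subnKC jm) => [|[|m']] => [||_]; [by left|lia|by right; exists m'].
  case=> [->|[m' ->]]; first by rewrite !take0.
  by rewrite /= !mem_cat !inE; lia.
- congr (_, _, _); rewrite sw /swap.
  rewrite take_cat szs1 ltnn subnn take0 cats0.
  rewrite !nth_cat szs1 ltnn subnn.
  have -> : (j < j.-1) = false by lia.
  have -> : j - j.-1 = 1 by lia.
  rewrite drop_cat szs1; have -> : (j.+1 < j.-1) = false by lia.
  have -> : j.+1 - j.-1 = 2 by lia.
  by rewrite /= drop0 es.
apply: contraL us => /eqP[]; rewrite sw es => /eqP.
rewrite eqseq_cat // eqxx /= => /eqP[-> _].
by rewrite cat_uniq /= mem_head /= !andbF.
Qed.

(** * Doors on the boundary of the cube *)

Definition setx (a v : nat) x : point := [ffun i => if val i == a then inord v else x i].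

(* The label conditions force a door on the boundary to be opposite to the
   initial vertex and to lie in the face x_k = p. *)
Lemma bdry_door k x s j : k.+1 <= N -> (x, s, j) \in doors k -> bdry k.+1 (x, s, j) ->
  [/\ j = 0, exists s', s = k :: s' & coord x k = p.-1].
Proof.
move=> kN; rewrite mem_doors => /and4P[]; rewrite /fst /snd => okxx ps jk dj.
have szs : size s = k.+1 by rewrite (perm_size ps) size_iota.
have us : uniq s by rewrite (perm_uniq ps) iota_uniq.
have sk a : a \in s -> a < k.+1 by rewrite (perm_mem ps) mem_iota.
case/orP => /andP[/eqP j0 /eqP xa]; subst j.
  case: s ps szs us sk dj xa => [//|a s] ps [szs] /andP[als us] sk dj xa.
  suff ak : a = k by split=> //; [exists s; rewrite ak|rewrite -ak].
  have ak := sk a (mem_head _ _); apply/eqP; rewrite eqn_leq -ltnS ak /=.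
  have : k \in iota 0 k.+1 by rewrite mem_iota /=.
  rewrite -(perm_mem dj) filter_iota0 => /mapP[m]; rewrite mem_iota => mk ->.
  have [i ia] : exists i : 'I_N, a = val i by exists (Ordinal (leq_trans ak kN)).
  rewrite [in X in _ <= X]ia; apply: lbl_leqp; rewrite ffunE /=.
  have -> : x i = p.-1 :> nat by rewrite -xa /= ia coordE.
  have -> : nat_of_ord i \in take m (a :: s).
    by case: m mk => // m _; rewrite /= ia mem_head.
  by rewrite addn1 prednK.
case/lastP: s ps szs us sk dj xa => [//|s a] ps szs us sk dj xa.
rewrite rcons_uniq in us; have {us} [als us] := andP us.
rewrite size_rcons in szs; case: szs => szs.
have ak : a < k.+1 by apply: sk; rewrite mem_rcons mem_head.
have : a \in iota 0 k.+1 by rewrite mem_iota.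
rewrite -(perm_mem dj) filter_iota_last => /mapP[m]; rewrite mem_iota => mk am.
have [i ia] : exists i : 'I_N, a = val i by exists (Ordinal (leq_trans ak kN)).
have /lbl_neq0 : vtx x (rcons s a) m i = 0.
  rewrite ffunE -coordE -[nat_of_ord i]/(val i) -ia; rewrite last_rcons in xa.
  rewrite xa -cats1 takel_cat; last by rewrite szs; lia.
  by have /negbTE -> : a \notin take m s by apply: contra als; apply: mem_take.
by rewrite -/(vlbl x (rcons s a) m) -am ia eqxx.
Qed.

Lemma setx_id a v x (i : 'I_N) : val i = a -> x i = v :> nat -> setx a v x = x.
Proof.
move=> ia xiv; apply/ffunP => j; rewrite ffunE; case: eqP => // ja.
by have -> : j = i by [apply: val_inj; rewrite ia]; rewrite -xiv inord_val.
Qed.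

Lemma setxK a v w x : setx a v (setx a w x) = setx a v x.
Proof. by apply/ffunP => j; rewrite !ffunE; case: eqP. Qed.

Lemma vtx_setx k x s m (i : 'I_N) : val i = k -> perm_eq s (iota 0 k) -> x i = p.-1 :> nat ->
  vtx (setx k p x) s m = vtx x (k :: s) m.+1.
Proof.
move=> ik ps xi; apply/ffunP => j; rewrite !ffunE /= inE.
case: (eqVneq (val j) k) => // jk; rewrite inordK //.
have -> : j = i by apply: val_inj; rewrite ik.
rewrite xi -[nat_of_ord i]/(val i) ik addn1 prednK //.
suff /negbTE -> : k \notin take m s by rewrite addn0.
by apply/negP => /mem_take; rewrite (perm_mem ps) mem_iota; lia.
Qed.

Lemma full_setx k x s (i : 'I_N) : val i = k -> perm_eq s (iota 0 k) -> x i = p.-1 :> nat ->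
  full k (setx k p x, s) = door k (x, k :: s) 0.
Proof.
move=> ik ps xi; rewrite /full /door filter_iota0; congr perm_eq.
rewrite -[1]addn0 iotaDl -map_comp; apply/eq_in_map => m _.
by rewrite /vlbl /= (vtx_setx _ ik ps xi).
Qed.

(** The facet of a boundary door is a full simplex one dimension lower, in the face where coordinate
    [k] is [p]. Conversely [psi] extends such a simplex to a door by starting one step earlier in
    direction [k]. *)
Lemma count_bdry_doors k : k.+1 <= N ->
  count (bdry k.+1) (doors k) = count (full k) (simplices k).
Proof.
move=> kN; have [i ik] : exists i : 'I_N, val i = k by exists (Ordinal kN).
pose psi (e : point * seq nat) := (setx k p.-1 e.1, k :: e.2, 0).
have setxE v (x : point) : v <= p -> setx k v x i = v :> nat.
  by move=> vp; rewrite ffunE ik eqxx inordK.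
have okS (x : point) : okx k x -> okx k.+1 (setx k p.-1 x).
  move=> /forallP okxx; apply/forallP => j; have := okxx j; rewrite ffunE.
  case: (eqVneq (val j) k) => [->|jk]; first by rewrite ltnSn inordK //; lia.
  have -> // : (j < k.+1) = (j < k).
  by rewrite ltnS leq_eqVlt -[nat_of_ord j]/(val j) (negbTE jk).
have okP (x : point) : okx k.+1 x -> okx k (setx k p x).
  move=> /forallP okxx; apply/forallP => j; have := okxx j; rewrite ffunE.
  case: (eqVneq (val j) k) => [->|jk]; first by rewrite ltnn inordK.
  have -> // : (j < k.+1) = (j < k).
  by rewrite ltnS leq_eqVlt -[nat_of_ord j]/(val j) (negbTE jk).
have ps_cons (s : seq nat) : perm_eq (k :: s) (iota 0 k.+1) = perm_eq s (iota 0 k).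
  by rewrite -[k.+1]addn1 iotaD perm_sym perm_catC perm_cons perm_sym.
rewrite -!size_filter -(size_map psi); apply/perm_size/uniq_perm.
- by rewrite filter_uniq // doors_uniq.
- rewrite map_inj_in_uniq ?filter_uniq ?simplices_uniq // => -[x s] [x' s'].
  rewrite !mem_filter !mem_simplices => /and3P[_ h1 _] /and3P[_ h2 _] /= [] e <-.
  have := congr1 (setx k p) e; rewrite !setxK.
  have ki : k <= i by rewrite -ik.
  by rewrite !(setx_id ik) ?(okx_ge h1 ki) ?(okx_ge h2 ki) // => ->.
move=> [[x s] j]; rewrite mem_filter; apply/andP/mapP => [[b d]|].
  have [j0 [s' es] xk] := bdry_door kN d b; subst s j.
  have xi : x i = p.-1 :> nat by rewrite -xk -ik coordE.
  move: d; rewrite mem_doors => /and4P[]; rewrite /fst /snd ps_cons => okxx ps _ dj.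
  exists (setx k p x, s'); last by rewrite /psi /= setxK (setx_id ik xi).
  rewrite mem_filter (full_setx ik ps xi) dj mem_simplices.
  by rewrite okP.
move=> [[x' s'] + [-> -> ->]]; rewrite mem_filter mem_simplices => /and3P[fl okx' ps'].
rewrite /fst /snd in okx' ps' *.
have xi := setxE p.-1 x' (leq_pred p).
split; first by rewrite /bdry /= -[X in coord _ X]ik coordE xi eqxx.
rewrite mem_doors /fst /snd okS // ps_cons ps' /= -(full_setx ik ps' xi) setxK.
by rewrite (setx_id ik) // (okx_ge okx') // -ik.
Qed.

(** Modulo 2, the doors are as many as the full [k.+1]-simplices by [odd_size_doors], and as many as
    the full [k]-simplices once [pivot] has paired off the interior ones. *)
Lemma odd_full k : k <= N -> odd (count (full k) (simplices k)).
Proof.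
elim: k => [_|k IH kN].
  (* The only 0-simplex is the corner with all coordinates [p], and its label is forced to be 0. *)
  suff -> : simplices 0 = [:: ([ffun=> ord_max], [::])].
    rewrite /= addn0 oddb /full /=; suff -> : vlbl [ffun=> ord_max] [::] 0 = 0 by [].
    have [N0|N0] := posnP N; first by apply/eqP; rewrite -leqn0 -N0 lbl_leN.
    apply/eqP; rewrite -leqn0 -[X in _ <= X]/(val (Ordinal N0)); apply: lbl_leqp.
    by rewrite !ffunE addn0.
  apply: perm_small_eq => //; apply: uniq_perm => //; first exact: simplices_uniq.
  case=> x s; rewrite mem_simplices inE /=; apply/andP/eqP => [[h1 h2]|[-> ->]].
    rewrite (perm_small_eq _ h2) //; congr (_, _); apply/ffunP => i; rewrite ffunE.
    by apply: val_inj; rewrite /= (okx_ge h1).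
  by split=> //; apply/forallP => i; rewrite /= ffunE.
rewrite -odd_size_doors // -(count_predC (bdry k.+1)) oddD count_bdry_doors // IH 1?ltnW //.
rewrite -size_filter; apply: (@involution_even_size _ (pivot k.+1)).
  by rewrite filter_uniq // doors_uniq.
move=> t; rewrite mem_filter => /andP[tb td].
by have [h1 h2 h3 h4] := pivotP kN td tb; rewrite mem_filter /= h2.
Qed.

Lemma exists_full_simplex : exists x s, (forall i, x i < p) /\
  forall a, a <= N -> exists j, lbl (vtx x s j) = a.
Proof.
have : 0 < count (full N) (simplices N).
  by rewrite lt0n; apply/negP => /eqP e; have := odd_full (leqnn N); rewrite e.
rewrite -has_count => /hasP[[x s]]; rewrite mem_simplices => /andP[okxx ps] fl.
exists x, s; split=> [i|a aN]; first exact: (okx_lt okxx).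
have : a \in iota 0 N.+1 by rewrite mem_iota.
by rewrite -(perm_mem fl) => /mapP[j _ ->]; exists j.
Qed.

End Kuhn.

(** Label [v] by the first [i] with [lab v i], and by [N] if there is none. In a full simplex the
    vertex labelled [i] serves as [r], and the vertex labelled [N], where every [lab _ i] fails,
    serves as [t]. *)
Lemma Kuhn_cube N p (lab : {ffun 'I_N -> nat} -> 'I_N -> bool) : 0 < p ->
  (forall (v : {ffun 'I_N -> nat}) i, v i = 0 -> ~~ lab v i) ->
  (forall (v : {ffun 'I_N -> nat}) i, v i = p -> lab v i) ->
  exists z : {ffun 'I_N -> nat}, (forall i, z i < p) /\
  forall i, exists r t : {ffun 'I_N -> nat},
  [/\ forall j, z j <= r j <= (z j).+1, forall j, z j <= t j <= (z j).+1,
      lab r i & ~~ lab t i].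
Proof.
move=> p0 lab0 labp; pose lbl v := find (lab v) (enum 'I_N).
have lblN v : lbl v <= N by rewrite (leq_trans (find_size _ _)) // size_enum_ord.
have lbl_lab v (i : 'I_N) : lbl v = i -> lab v i.
  move=> e; have h : has (lab v) (enum 'I_N).
    by rewrite has_find size_enum_ord -/(lbl v) e.
  by have := nth_find i h; rewrite -/(lbl v) e nth_ord_enum.
have lab_lbl v (i : 'I_N) : lab v i -> lbl v <= i.
  move=> li; rewrite leqNgt; apply/negP => /(before_find i).
  by rewrite nth_ord_enum li.
have [||x [s [xp fs]]] := exists_full_simplex p0 lblN.
- by move=> v i vi; apply: contraNneq (lab0 v i vi) => /lbl_lab.
- by move=> v i vi; apply/lab_lbl/labp.
exists [ffun i => x i : nat]; split=> [i|i]; first by rewrite ffunE.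
have [j1 e1] := fs i (ltnW (ltn_ord i)); have [j2 e2] := fs N (leqnn N).
exists (vtx x s j1), (vtx x s j2); split.
- by move=> j; rewrite !ffunE; case: (_ \in _) => /=; lia.
- by move=> j; rewrite !ffunE; case: (_ \in _) => /=; lia.
- exact: lbl_lab.
by apply/negP => /lab_lbl; rewrite e2 leqNgt ltn_ord.
Qed.

Local Open Scope ring_scope.
Local Open Scope classical_set_scope.

(** * Brouwer's fixed point theorem on a box *)

Section Brouwer.
Variables (R : realType) (N : nat).

Lemma box_compact (b : R) : compact [set x : 'rV[R]_N | forall i, `|x 0 i| <= b].
Proof.
rewrite (_ : [set _ | _] = [set x : 'rV[R]_N | forall i, `[- b, b] (x 0 i)]).
  by apply: (@rV_compact R N (fun=> `[- b, b])) => i; exact: segment_compact.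
apply/seteqP; split=> x /= xb i; have := xb i; rewrite in_itv /= ler_norml //.
Qed.

Variables (b : R) (f : 'I_N -> 'rV[R]_N -> R).
Hypothesis b_gt0 : 0 < b.
Hypothesis f_cont : forall i, continuous (f i).
Hypothesis f_box :
  forall x : 'rV[R]_N, (forall i, `|x 0 i| <= b) -> forall i, `|f i x| <= b.

Let grid p (v : {ffun 'I_N -> nat}) : 'rV[R]_N :=
  \row_i (- b + (2 * b) * ((v i)%:R / p%:R)).

Let grid_box p (v : {ffun 'I_N -> nat}) : (0 < p)%N -> (forall i, v i <= p)%N ->
  forall i, `|grid p v 0 i| <= b.
Proof.
move=> p0 vp i; rewrite mxE ler_norml.
have : 0 <= (v i)%:R / p%:R :> R by rewrite divr_ge0.
have : (v i)%:R / p%:R <= 1 :> R by rewrite ler_pdivrMr ?ltr0n // mul1r ler_nat.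
move: (_ / _) => q q1 q0; have b0 := ltW b_gt0.
have := mulr_ge0 b0 q0; have : 0 <= b * (1 - q) by rewrite mulr_ge0 ?subr_ge0.
by rewrite -mulrA mulrBr mulr1; move: (b * q) => c; lra.
Qed.

Lemma approx_fixed p : (0 < p)%N -> exists2 y : 'rV[R]_N, (forall i, `|y 0 i| <= b) &
  forall i, exists r t : 'rV[R]_N,
  [/\ forall j, `|y 0 j - r 0 j| <= 2 * b / p%:R,
      forall j, `|y 0 j - t 0 j| <= 2 * b / p%:R,
      f i r <= r 0 i & t 0 i <= f i t].
Proof.
(* [lab v i] records that [f] does not increase coordinate [i], with the values on the faces
   [v i = 0] and [v i = p] forced as [Kuhn_cube] requires. Since [f] maps the box to itself, the
   forced values still yield the wanted inequalities. *)
move=> p0; pose lab (v : {ffun 'I_N -> nat}) i :=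
  (v i != 0)%N && ((p <= v i)%N || (f i (grid p v) <= grid p v 0 i)).
have [|v i vi|z [zp zlab]] := @Kuhn_cube N p lab p0.
- by move=> v i vi; rewrite /lab vi.
- by rewrite /lab vi -lt0n p0 leqnn.
exists (grid p z) => [|i]; first by apply: grid_box => // i; exact/ltnW.
have [r [t [rz tz lr lt]]] := zlab i.
have near (v : {ffun 'I_N -> nat}) : (forall j, z j <= v j <= (z j).+1)%N ->
    forall j, `|grid p z 0 j - grid p v 0 j| <= 2 * b / p%:R.
  move=> vz j; rewrite !mxE.
  have -> : - b + 2 * b * ((z j)%:R / p%:R) - (- b + 2 * b * ((v j)%:R / p%:R))
          = (2 * b / p%:R) * ((z j)%:R - (v j)%:R) by ring.
  rewrite normrM ger0_norm; last by rewrite divr_ge0 // mulr_ge0 // ltW.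
  rewrite ler_piMr ?divr_ge0 ?mulr_ge0 // ?(ltW b_gt0) // distrC.
  case/andP: (vz j) => zv vz1; rewrite -natrB // normr_nat.
  by rewrite -[leRHS]/(1%:R) ler_nat leq_subLR addn1.
have inbox (v : {ffun 'I_N -> nat}) : (forall j, z j <= v j <= (z j).+1)%N ->
    forall j, `|grid p v 0 j| <= b.
  move=> vz; apply: grid_box => // j; case/andP: (vz j) => _ /leq_trans; apply.
  exact: zp.
exists (grid p r), (grid p t); split; [exact: near|exact: near| |].
- case/andP: lr => _ /orP[pr|//].
  have -> : grid p r 0 i = b.
    have -> : (grid p r 0 i = - b + 2 * b * ((r i)%:R / p%:R)) by rewrite mxE.
    have -> : r i = p by have := rz i; have := zp i; lia.
    by rewrite divff ?pnatr_eq0 -?lt0n //; ring.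
  by have := f_box (inbox r rz) i; rewrite ler_norml => /andP[].
- move: lt; rewrite /lab negb_and negb_or negbK => /orP[/eqP ti|/andP[_]].
    have -> : grid p t 0 i = - b by rewrite mxE ti mul0r mulr0 addr0.
    by have := f_box (inbox t tz) i; rewrite ler_norml => /andP[].
  by rewrite -ltNge => /ltW.
Qed.

(** Take a cluster point [x] of the points given by [approx_fixed]. A strict inequality between
    [f i x] and [x 0 i] would persist on a neighbourhood of [x], yet every neighbourhood contains
    points [r] and [t] with the two opposite weak inequalities. *)
Theorem Brouwer_box :
  exists2 x : 'rV[R]_N, (forall i, `|x 0 i| <= b) & forall i, f i x = x 0 i.
Proof.
have /choice[y yP] : forall p, exists y : 'rV[R]_N, (forall i, `|y 0 i| <= b) /\
  forall i, exists r t : 'rV[R]_N,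
  [/\ forall j, `|y 0 j - r 0 j| <= 2 * b / p.+1%:R,
      forall j, `|y 0 j - t 0 j| <= 2 * b / p.+1%:R,
      f i r <= r 0 i & t 0 i <= f i t].
  by move=> p; have [z zb zP] := approx_fixed (ltn0Sn p); exists z.
have [|x [xb xcl]] := @box_compact b (y @ \oo) _.
  by exists 0%N => // p _ /= i; have [yb _] := yP p.
exists x => // i.
have close (A : set 'rV[R]_N) : nbhs x A -> exists p, forall r : 'rV[R]_N,
    (forall j, `|y p 0 j - r 0 j| <= 2 * b / p.+1%:R) -> A r.
  move=> /nbhs_ballP[e /= e0 eA].
  have [p _ ple] : \forall p \near \oo, 2 * b / p.+1%:R < e / 2.
    near=> p; rewrite ltr_pdivrMr ?ltr0n // -ltr_pdivrMl ?divr_gt0 //.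
    rewrite (@lt_le_trans _ _ p%:R) ?ler_nat //.
    by near: p; exact: nbhs_infty_gtr.
  have [z [[q /= pq <-] [_ zx]]] : [set y q | q in [set q | (p <= q)%N]] `&` ball x (e / 2) !=set0.
    apply: xcl; last exact/nbhsx_ballx/divr_gt0.
    by exists p => // q /= pq; exists q.
  exists q => r yr; apply: eA; split=> // i0 j; rewrite (ord1 i0) /ball /=.
  have := zx 0 j; rewrite /ball /= => h1; have := yr j => h2; have := ple q pq => /= h3.
  rewrite (_ : x 0 j - r 0 j = (x 0 j - y q 0 j) + (y q 0 j - r 0 j)); last by ring.
  by rewrite (le_lt_trans (ler_normD _ _)) // [e]splitr ltrD // (le_lt_trans h2).
have g_cont : (fun z : 'rV[R]_N => f i z - z 0 i) @ x --> f i x - x 0 i.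
  by apply: (@cvgB _ _ _ (nbhs x)); [exact: f_cont|exact: coord_continuous].
apply/eqP; rewrite -subr_eq0 eq_le; apply/andP; split; rewrite leNgt; apply/negP => gx.
- have /close[p pP] : \forall z \near x, 0 < f i z - z 0 i.
    exact: (cvgr_gt (f i x - x 0 i) g_cont 0 gx).
  have [r [t [yr yt fr ft]]] := (yP p).2 i.
  by have := pP r yr; rewrite /= subr_gt0 ltNge fr.
- have /close[p pP] : \forall z \near x, f i z - z 0 i < 0.
    exact: (cvgr_lt (f i x - x 0 i) g_cont 0 gx).
  have [r [t [yr yt fr ft]]] := (yP p).2 i.
  by have := pP t yt; rewrite /= subr_lt0 ltNge ft.
Unshelve. all: by end_near.
Qed.

End Brouwer.

Local Open Scope complex_scope.
Local Open Scope sesquilinear_scope.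

(** * Spectral calculus and the Frobenius norm *)

Section Frobenius.
Variable R : realType.
Local Notation C := R[i].

Definition normsq (z : C) : R := complex.Re z ^+ 2 + complex.Im z ^+ 2.

Lemma normsqE (z : C) : (normsq z)%:C = z * z^*.
Proof. by rewrite -normCK /normsq add_Re2_Im2. Qed.

Lemma normsq_ge0 (z : C) : 0 <= normsq z.
Proof. by rewrite addr_ge0 ?sqr_ge0. Qed.

Lemma normsq_eq0 (z : C) : (normsq z == 0) = (z == 0).
Proof.
by case: z => a b; rewrite /normsq paddr_eq0 ?sqr_ge0 // !sqrf_eq0 eq_complex.
Qed.

Lemma normsqM (z w : C) : normsq (z * w) = normsq z * normsq w.
Proof. by case: z w => [a b] [c d]; rewrite /normsq /=; ring. Qed.

Lemma normsqR (a : R) : normsq a%:C = a ^+ 2.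
Proof. by rewrite /normsq /= expr0n addr0. Qed.

Definition frob2 m n (A : 'M[C]_(m, n)) : R := \sum_i \sum_j normsq (A i j).

Lemma frob2E m n (A : 'M[C]_(m, n)) : (frob2 A)%:C = \tr (A *m A^t*).
Proof.
rewrite /frob2 /mxtrace rmorph_sum; apply: eq_bigr => i _.
rewrite mxE rmorph_sum; apply: eq_bigr => j _; rewrite !mxE; exact: normsqE.
Qed.

Lemma normsq_le_frob2 m n (A : 'M[C]_(m, n)) i j : normsq (A i j) <= frob2 A.
Proof.
rewrite /frob2 (bigD1 i) //= (bigD1 j) //= -addrA lerDl addr_ge0 //.
  by apply: sumr_ge0 => *; exact: normsq_ge0.
by apply: sumr_ge0 => *; apply: sumr_ge0 => *; exact: normsq_ge0.
Qed.

Lemma frob2_ge0 m n (A : 'M[C]_(m, n)) : 0 <= frob2 A.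
Proof. by apply: sumr_ge0 => i _; apply: sumr_ge0 => j _; exact: normsq_ge0. Qed.

Lemma frob2_eq0 m n (A : 'M[C]_(m, n)) : frob2 A = 0 -> A = 0.
Proof.
move=> A0; apply/matrixP => i j; rewrite mxE; apply/eqP.
by rewrite -normsq_eq0 eq_le normsq_ge0 andbT -A0 normsq_le_frob2.
Qed.

Lemma unitary_adjl n (V : 'M[C]_n) : V \is unitarymx -> V^t* *m V = 1%:M.
Proof. by move=> /unitarymxP VV; apply: mulmx1C. Qed.

Lemma frob2_unitaryr m n (A : 'M[C]_(m, n)) (V : 'M[C]_n) :
  V \is unitarymx -> frob2 (A *m V) = frob2 A.
Proof.
move=> /unitarymxP VV; apply: complexI; rewrite !frob2E adjmxM.
by rewrite mulmxA -[A *m V *m _]mulmxA VV mulmx1.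
Qed.

Lemma frob2_unitaryl m n (A : 'M[C]_(m, n)) (V : 'M[C]_m) :
  V \is unitarymx -> frob2 (V *m A) = frob2 A.
Proof.
move=> Vu; apply: complexI; rewrite !frob2E adjmxM -!mulmxA mxtrace_mulC.
by rewrite -!mulmxA (unitary_adjl Vu) mulmx1.
Qed.

Variable n : nat.
Implicit Types (A V U : 'M[C]_n) (d e : 'I_n -> R).

Lemma frob2_unitary V : V \is unitarymx -> frob2 V = n%:R.
Proof.
by move=> /unitarymxP VV; apply: complexI; rewrite frob2E VV mxtrace1 rmorph_nat.
Qed.

(** The convention is that of [spectralmx]: for unitary [V] the eigenvectors are the columns of
    [V^t*]. *)
Definition spec V d : 'M[C]_n := V^t* *m diag_mx (\row_j (d j)%:C) *m V.

Lemma diag_adj d : (diag_mx (\row_j (d j)%:C) : 'M[C]_n)^t* = diag_mx (\row_j (d j)%:C).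
Proof.
apply/matrixP => i j; rewrite !mxE eq_sym; case: eqP => [->|_].
  by rewrite !mulr1n; exact: conjc_real.
by rewrite !mulr0n rmorph0.
Qed.

Lemma spec_adj V d : (spec V d)^t* = spec V d.
Proof. by rewrite /spec !adjmxM adjmxK diag_adj mulmxA. Qed.

Lemma diag_congr V (r s : 'rV[C]_n) : r = s ->
  V^t* *m diag_mx r *m V = V^t* *m diag_mx s *m V.
Proof. by move=> ->. Qed.

Lemma eq_spec V d e : d =1 e -> spec V d = spec V e.
Proof. by move=> de; apply: diag_congr; apply/rowP => j; rewrite !mxE de. Qed.

Lemma specB V d e : spec V d - spec V e = spec V (fun i => d i - e i).
Proof.
rewrite /spec -mulmxBl -mulmxBr -linearB; apply: diag_congr.
by apply/rowP => j; rewrite !mxE rmorphB.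
Qed.

Lemma specZ V d (a : R) : a%:C *: spec V d = spec V (fun i => a * d i).
Proof.
rewrite /spec scalemxAl scalemxAr -linearZ; apply: diag_congr.
by apply/rowP => j; rewrite !mxE rmorphM.
Qed.

Lemma spec_trace_mul V d A :
  \tr (spec V d *m A) = \sum_i (d i)%:C * (V *m A *m V^t*) i i.
Proof.
rewrite /spec -!mulmxA mxtrace_mulC -mulmxA -mulmxA [in LHS]mulmxA -mulmxA.
by apply: eq_bigr => i _; rewrite mul_diag_mx !mxE.
Qed.

Lemma spec_const V (a : R) : V \is unitarymx -> spec V (fun=> a) = (a%:C)%:M.
Proof.
move=> Vu; rewrite /spec (_ : diag_mx _ = a%:C%:M).
  by rewrite mul_mx_scalar -scalemxAl (unitary_adjl Vu) scalemx1.
by apply/matrixP => i j; rewrite !mxE.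
Qed.

Lemma spec_mul V d (x : 'cV[C]_n) i : V \is unitarymx ->
  (V *m (spec V d *m x)) i 0 = (d i)%:C * (V *m x) i 0.
Proof.
move=> /unitarymxP VV; rewrite /spec !mulmxA VV mul1mx -mulmxA.
by rewrite mul_diag_mx !mxE.
Qed.

(* In the eigenbases of two Hermitian matrices their difference has entries
   (d i - e j) X i j, which turns scalar estimates into matrix estimates. *)
Lemma frob2_specB V U d e : V \is unitarymx -> U \is unitarymx ->
  frob2 (spec V d - spec U e) =
  \sum_i \sum_j (d i - e j) ^+ 2 * normsq ((V *m U^t*) i j).
Proof.
move=> Vu Uu; have U'u : U^t* \is unitarymx by rewrite trmxC_unitary.
rewrite -(frob2_unitaryl _ Vu) -(frob2_unitaryr _ U'u).
apply: eq_bigr => i _; apply: eq_bigr => j _; rewrite -normsqR -normsqM; congr normsq.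
have /unitarymxP VV := Vu; have /unitarymxP UU := Uu.
rewrite mulmxBr mulmxBl {1}/spec !mulmxA VV mul1mx.
rewrite -[_ *m U *m U^t*]mulmxA UU mulmx1 -[diag_mx _ *m V *m _]mulmxA.
by rewrite mul_diag_mx mul_mx_diag !mxE rmorphB mulrBl [in X in _ - X]mulrC.
Qed.

(** The left side of [frob2_specB] is zero, hence so is each nonnegative term on the right. This is
    the orthogonality of eigenvectors for distinct eigenvalues. *)
Lemma spec_eq_eigen V U d e : V \is unitarymx -> U \is unitarymx ->
  spec V d = spec U e -> forall i j, d i = e j \/ (V *m U^t*) i j = 0.
Proof.
move=> Vu Uu E i j; have := frob2_specB d e Vu Uu.
rewrite E subrr {1}/frob2 big1 => [|k _]; last first.
  by rewrite big1 // => l _; rewrite mxE normsqR expr0n.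
move=> /esym/eqP; rewrite psumr_eq0 => [/allP/(_ i (mem_index_enum _))|k _]; last first.
  by apply: sumr_ge0 => l _; rewrite mulr_ge0 ?sqr_ge0 ?normsq_ge0.
rewrite /= psumr_eq0 => [/allP/(_ j (mem_index_enum _))|l _]; last first.
  by rewrite mulr_ge0 ?sqr_ge0 ?normsq_ge0.
by rewrite /= mulf_eq0 sqrf_eq0 subr_eq0 normsq_eq0 => /orP[/eqP|/eqP]; [left|right].
Qed.

(** Otherwise column [j] of the unitary matrix [V *m U^t*] would vanish. *)
Lemma spec_eigen_sub V U d e : V \is unitarymx -> U \is unitarymx ->
  spec V d = spec U e -> forall j, exists i, e j = d i.
Proof.
move=> Vu Uu E j; apply: contrapT => /forallNP ne.
have X0 i : (V *m U^t*) i j = 0.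
  by case: (spec_eq_eigen Vu Uu E i j) => // de; case: (ne i).
have : (U *m (V^t* *m (V *m U^t*))) j j = 0.
  by rewrite mulmxA mxE big1 // => i _; rewrite X0 mulr0.
rewrite [V^t* *m _]mulmxA (unitary_adjl Vu) mul1mx (unitarymxP Uu) mxE eqxx.
by move=> /eqP; rewrite oner_eq0.
Qed.

(** Functional calculus does not depend on the chosen diagonalisation: a pair of indices contributes
    only where the eigenvalues already agree. *)
Lemma spec_fun V U d e (g : R -> R) : V \is unitarymx -> U \is unitarymx ->
  spec V d = spec U e -> spec V (g \o d) = spec U (g \o e).
Proof.
move=> Vu Uu E; apply/eqP; rewrite -subr_eq0; apply/eqP/frob2_eq0.
rewrite frob2_specB // big1 // => i _; rewrite big1 // => j _ /=.
case: (spec_eq_eigen Vu Uu E i j) => [->|->]; first by rewrite subrr expr0n mul0r.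
by rewrite normsqR expr0n mulr0.
Qed.

Definition eig A (i : 'I_n) : R := complex.Re (spectral_diag A 0 i).

Definition hfun (g : R -> R) A : 'M[C]_n := spec (spectralmx A) (g \o eig A).

Lemma herm_spec A : A^t* = A -> spec (spectralmx A) (eig A) = A.
Proof.
move=> Ah; have Vu := spectral_unitarymx A.
have /orthomx_spectralP A_eq : A \is normalmx by apply/normalmxP; rewrite Ah.
rewrite invmx_unitary // in A_eq.
apply: etrans (esym A_eq); apply: diag_congr; apply/rowP => j.
have : (diag_mx (spectral_diag A))^t* = diag_mx (spectral_diag A).
  have -> : diag_mx (spectral_diag A) = spectralmx A *m A *m (spectralmx A)^t*.
    rewrite {3}A_eq !mulmxA (unitarymxP Vu) mul1mx -mulmxA.
    by rewrite (unitarymxP Vu) mulmx1.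
  by rewrite !adjmxM adjmxK Ah mulmxA.
move=> /matrixP/(_ j j); rewrite !mxE eqxx !mulr1n /eig.
case: (spectral_diag A 0 j) => a b [] nb.
by suff -> : b = 0 by []; lra.
Qed.

Lemma hfun_spec g V d : V \is unitarymx -> hfun g (spec V d) = spec V (g \o d).
Proof.
move=> Vu; apply: (spec_fun _ (spectral_unitarymx _) Vu).
exact/herm_spec/spec_adj.
Qed.

Lemma eig_spec V d j : V \is unitarymx -> exists i, eig (spec V d) j = d i.
Proof.
move=> Vu; apply: (spec_eigen_sub Vu (spectral_unitarymx (spec V d))).
exact/esym/herm_spec/spec_adj.
Qed.

Lemma mxpow_hfun A (r : R) : mxpow A r = hfun (fun x => powR x r) A.
Proof.
by apply: diag_congr; apply/rowP => j; rewrite !mxE.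
Qed.

(** By [frob2_specB] both norms are sums over pairs of eigenvalues with the same weights, the
    squared moduli of the entries of a unitary matrix, whose total is [n]. Each pair is estimated by
    [(a + b)^2 <= 2 a^2 + 2 b^2]. *)
Lemma frob2_hfunB g A B (eps L : R) : A^t* = A -> B^t* = B -> 0 <= eps -> 0 <= L ->
  (forall i j, `|g (eig A i) - g (eig B j)| <= eps + L * `|eig A i - eig B j|) ->
  frob2 (hfun g A - hfun g B) <= 2 * eps ^+ 2 * n%:R + 2 * L ^+ 2 * frob2 (A - B).
Proof.
move=> Ah Bh e0 L0 gL; have Vu := spectral_unitarymx A; have Uu := spectral_unitarymx B.
have Xu : spectralmx A *m (spectralmx B)^t* \is unitarymx.
  by apply: (mul_unitarymx Vu); rewrite trmxC_unitary.
have := frob2_specB (eig A) (eig B) Vu Uu; rewrite (herm_spec Ah) (herm_spec Bh) => ->.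
rewrite /hfun (frob2_specB _ _ Vu Uu) -(frob2_unitary Xu) /frob2 !mulr_sumr -big_split.
apply: ler_sum => i _ /=; rewrite !mulr_sumr -big_split; apply: ler_sum => j _ /=.
rewrite mulrA -mulrDl; apply: ler_wpM2r; first exact: normsq_ge0.
have := gL i j; set x := g _ - _; set y := eig A i - _ => xy.
have : `|x| ^+ 2 <= (eps + L * `|y|) ^+ 2.
  by rewrite ler_pXn2r ?nnegrE // addr_ge0 // mulr_ge0.
rewrite real_normK ?num_real // => /le_trans; apply.
rewrite -(real_normK (num_real y)); move: `|y| => z.
have := sqr_ge0 (eps - L * z); lra.
Qed.

End Frobenius.

(** * Quadratic forms of symmetric words *)

Section Forms.
Variables (R : realType) (n : nat).
Local Notation C := R[i].
Implicit Types (A B M V U : 'M[C]_n) (d e : 'I_n -> R) (x : 'cV[C]_n).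

Definition qf A x : C := (x^t* *m A *m x) ord0 ord0.

Lemma qf_spec V d x : qf (spec V d) x = (\sum_i d i * normsq ((V *m x) i 0))%:C.
Proof.
rewrite /qf /spec !mulmxA -adjmxM -mulmxA -mulmxA mul_diag_mx mxE rmorph_sum.
apply: eq_bigr => i _; rewrite !mxE mulrCA [_^* * _]mulrC -normsqE -rmorphM.
by [].
Qed.

Lemma adj_qf A x : qf (A^t*) x = (qf A x)^*.
Proof.
have -> : qf (A^t*) x = ((x^t* *m A *m x)^t*) 0 0 by rewrite !adjmxM adjmxK mulmxA.
by rewrite mxE [_^T _ _]mxE.
Qed.

Lemma qf_conj A M x : qf (M^t* *m A *m M) x = qf A (M *m x).
Proof. by rewrite /qf adjmxM !mulmxA. Qed.

Lemma qfB A B x : qf (A - B) x = qf A x - qf B x.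
Proof. by rewrite /qf mulmxBr mulmxBl !mxE. Qed.

Lemma qfZ a A x : qf (a *: A) x = a * qf A x.
Proof. by rewrite /qf -scalemxAr -scalemxAl !mxE. Qed.

Definition eigvec V i : 'cV[C]_n := V^t* *m delta_mx i 0.

Lemma mul_eigvec V i : V \is unitarymx -> V *m eigvec V i = delta_mx i 0.
Proof. by move=> /unitarymxP VV; rewrite mulmxA VV mul1mx. Qed.

Lemma eigvec_neq0 V i : V \is unitarymx -> eigvec V i != 0.
Proof.
move=> Vu; apply/eqP => v0; have := mul_eigvec i Vu; rewrite v0 mulmx0.
by move=> /matrixP/(_ i 0); rewrite !mxE !eqxx => /esym/eqP; rewrite oner_eq0.
Qed.

Lemma qf_eigvec V d i : V \is unitarymx -> qf (spec V d) (eigvec V i) = (d i)%:C.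
Proof.
move=> Vu; rewrite qf_spec mul_eigvec // (bigD1 i) //= mxE !eqxx /=.
rewrite big1 => [|j ji]; last by rewrite mxE (negbTE ji) /= /normsq /= expr0n addr0 mulr0.
by rewrite /normsq /= expr1n expr0n !addr0 mulr1.
Qed.

Lemma spec_trace V d A : \tr (spec V d *m A) = \sum_i (d i)%:C * qf A (eigvec V i).
Proof.
rewrite spec_trace_mul; apply: eq_bigr => i _; congr (_ * _).
rewrite /qf /eigvec adjmxM adjmxK !mulmxA.
have -> : (delta_mx i 0 : 'cV[C]_n)^t* = delta_mx 0 i.
  by apply/matrixP => j k; rewrite !mxE andbC; case: (_ && _); rewrite ?rmorph1 ?rmorph0.
by rewrite -colE [RHS]mxE -!mulmxA -rowE [RHS]mxE.
Qed.

Lemma unitary_mul_eq0 V x : V \is unitarymx -> V *m x = 0 -> x = 0.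
Proof.
by move=> Vu Vx; rewrite -[x]mul1mx -(unitary_adjl Vu) -mulmxA Vx mulmx0.
Qed.

Lemma spec_ker V d x : V \is unitarymx ->
  spec V d *m x = 0 <-> forall i, d i = 0 \/ (V *m x) i 0 = 0.
Proof.
move=> Vu; split=> [sx i|dx].
  have := spec_mul d x i Vu; rewrite sx mulmx0 mxE => /esym/eqP.
  rewrite mulf_eq0 => /orP[/eqP[]|/eqP]; first by left.
  by right.
apply: (unitary_mul_eq0 Vu); apply/matrixP => i j; rewrite ord1 spec_mul // [RHS]mxE.
by case: (dx i) => ->; rewrite ?mul0r ?mulr0.
Qed.

Lemma posdef_spec V d : V \is unitarymx -> (forall i, 0 < d i) -> posdef (spec V d).
Proof.
move=> Vu d0; split; first exact: spec_adj.
move=> x x0; rewrite -/(qf _ _) qf_spec ltcR lt_neqAle.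
have s0 i : 0 <= d i * normsq ((V *m x) i 0).
  by rewrite mulr_ge0 ?normsq_ge0 // ltW.
rewrite sumr_ge0 ?andbT //; apply: contra x0 => /eqP/esym/eqP.
rewrite psumr_eq0 // => /allP sx; apply/eqP/(unitary_mul_eq0 Vu)/matrixP => i j.
rewrite ord1 [RHS]mxE; have := sx i (mem_index_enum _).
by rewrite mulf_eq0 normsq_eq0 gt_eqF //= => /eqP.
Qed.

Lemma completely_invertible_qf M x : completely_invertible M -> x != 0 -> qf M x != 0.
Proof.
move=> ci x0; apply/eqP => qx; apply: ci.
have nx : x^t* *m x = (frob2 x)%:C%:M.
  apply/matrixP => i j; rewrite !ord1 !mxE eqxx mulr1n /frob2 rmorph_sum.
  apply: eq_bigr => k _; rewrite big_ord1 !mxE mulrC; exact/esym/normsqE.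
have n0 : 0 < frob2 x.
  rewrite lt_neqAle eq_sym; apply/andP; split.
    by apply: contraNneq x0 => /frob2_eq0 ->.
  by apply: sumr_ge0 => *; apply: sumr_ge0 => *; exact: normsq_ge0.
pose a := (Num.sqrt (frob2 x))^-1; exists (a%:C *: x).
have axE : (a%:C *: x)^t* = a%:C *: x^t*.
  apply/matrixP => i j; rewrite !mxE rmorphM; congr (_ * _); exact: conjc_real.
rewrite axE; split.
  rewrite -scalemxAl -scalemxAr nx scalerA scale_scalar_mx -!rmorphM /a.
  rewrite -invfM -expr2 sqr_sqrtr ?(ltW n0) // mulVf ?gt_eqF //.
by rewrite -!scalemxAl -scalemxAr scalerA [RHS]mxE -/(qf M x) qx mulr0.
Qed.

Definition psd B := B^t* = B /\ forall i, 0 <= eig B i.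

Lemma psd_spec V d : V \is unitarymx -> (forall i, 0 <= d i) -> psd (spec V d).
Proof.
move=> Vu d0; split=> [|j]; first exact: spec_adj.
by have [i ->] := eig_spec d j Vu.
Qed.

(** Both matrices share an eigenbasis and, for [q > 0], the same zero eigenvalues. Positivity of [q]
    matters because [powR 0 0 = 1]. *)
Lemma mxpow_ker B q x : psd B -> 0 < q -> mxpow B q *m x = 0 <-> B *m x = 0.
Proof.
move=> [Bh B0] q0; rewrite mxpow_hfun -{2}(herm_spec Bh) /hfun.
have Vu := spectral_unitarymx B.
split=> /(spec_ker _ _ Vu) h; apply/(spec_ker _ _ Vu) => i;
  (case: (h i) => [/= e|]; [left|by right]).
  exact: powR_eq0_eq0 e.
by rewrite /= e powR0 // gt_eqF.
Qed.

Lemma qf_mxpow_gt0 B q x : psd B -> 0 < q -> B *m x != 0 -> 0 < qf (mxpow B q) x.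
Proof.
move=> psdB q0 Bx; have : mxpow B q *m x != 0.
  by apply: contraNneq Bx => /(mxpow_ker _ psdB q0)/eqP.
case: psdB => Bh B0; have Vu := spectral_unitarymx B.
rewrite mxpow_hfun /hfun qf_spec ltcR lt_neqAle => Sx.
rewrite sumr_ge0 ?andbT => [|i _]; last by rewrite mulr_ge0 ?powR_ge0 ?normsq_ge0.
apply: contra Sx => /eqP/esym/eqP.
rewrite psumr_eq0 => [/allP sx|i _]; last by rewrite mulr_ge0 ?powR_ge0 ?normsq_ge0.
apply/eqP/(spec_ker _ _ Vu) => i; have := sx i (mem_index_enum _).
by rewrite mulf_eq0 normsq_eq0 => /orP[/eqP|/eqP]; [left|right].
Qed.

(** * Symmetric words evaluated at semidefinite matrices *)

Definition word_size (p : seq R) (Cs : seq 'M[C]_n) :=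
  size p = (size Cs).+1 \/ (size p = size Cs /\ (0 < size Cs)%N).

Lemma word_size_ind (Q : seq R -> seq 'M[C]_n -> Prop) :
  (forall q, Q [:: q] [::]) -> (forall q M, Q [:: q] [:: M]) ->
  (forall q q' p M Cs, word_size (q' :: p) Cs -> Q (q' :: p) Cs ->
     Q [:: q, q' & p] (M :: Cs)) ->
  forall p Cs, word_size p Cs -> Q p Cs.
Proof.
move=> Q1 Q2 Q3 p Cs; elim: Cs p => [|M Cs IH] [|q [|q' p]].
- by case=> [|[]].
- by move=> _; exact: Q1.
- by case=> [|[]].
- by case=> [|[]].
- by move=> sz; have -> : Cs = [::]; [case: sz => [|[]]; case: (Cs)|exact: Q2].
move=> sz; have sz' : word_size (q' :: p) Cs.
  by case: sz => [[sz]|[[sz] _]]; [left; congr S|right; split; rewrite /= ?sz // -sz].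
exact/Q3/IH.
Qed.

(** When the sizes agree, the last matrix is the centre of the word and occurs there once, without
    its adjoint; otherwise the centre is a power and nothing is required. For sizes allowed by
    [word_size] the default [0] is never reached. *)
Definition mid_letter (Q : 'M[C]_n -> Prop) (p : seq R) (Cs : seq 'M[C]_n) :=
  size p = size Cs -> Q (last 0 Cs).

Lemma mid_letter_cons Q q q' p M Cs :
  mid_letter Q [:: q, q' & p] (M :: Cs) -> mid_letter Q (q' :: p) Cs.
Proof.
move=> h sz; have := h (congr1 S sz).
by case: Cs sz {h}.
Qed.

Lemma gsword1 q M A : gsword [:: q] [:: M] A = mxpow A q *m M *m mxpow A q.
Proof. by []. Qed.

Lemma gsword_cons q q' p M Cs A : gsword [:: q, q' & p] (M :: Cs) A =
  mxpow A q *m M *m gsword (q' :: p) Cs A *m M^t* *m mxpow A q.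
Proof. by []. Qed.

Lemma gsword_herm B p Cs : word_size p Cs ->
  mid_letter (fun M => M^t* = M) p Cs -> (gsword p Cs B)^t* = gsword p Cs B.
Proof.
move=> sz; move: p Cs sz; apply: word_size_ind => [q|q M|q q' p M Cs _ IH] mid.
- exact: mxpow_adj.
- rewrite gsword1; move: (mxpow B q) (mxpow_adj B q) => S Sh.
  by rewrite !adjmxM Sh (mid erefl) mulmxA.
rewrite gsword_cons; move: (mxpow B q) (mxpow_adj B q) => S Sh.
by rewrite !adjmxM adjmxK Sh (IH (mid_letter_cons mid)) !mulmxA.
Qed.

(* If y = M^* B^q x were in the kernel of B, hence of B^q, then u = B^q x would
   satisfy u^* M^* u = 0; so M^* maps the range of B off the kernel of B. *)
Lemma gsword_qf_gt0 B p Cs x : word_size p Cs -> psd B ->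
  (forall M, M \in Cs -> completely_invertible M) -> (forall q, q \in p -> 0 < q) ->
  mid_letter (@posdef R n) p Cs -> B *m x != 0 -> 0 < qf (gsword p Cs B) x.
Proof.
move=> sz psdB; move: p Cs sz x.
apply: word_size_ind => [q|q M|q q' p M Cs _ IH] x ci pos mid Bx.
- by apply: qf_mxpow_gt0 => //; apply: pos; rewrite mem_head.
- rewrite gsword1 -{1}(mxpow_adj B q) qf_conj; have [_] := mid erefl; apply.
  apply: contraNneq Bx => /(mxpow_ker _ psdB)-> //.
  by apply: pos; rewrite mem_head.
have q0 : 0 < q by apply: pos; rewrite mem_head.
have kerS y := mxpow_ker y psdB q0; rewrite gsword_cons.
move: (mxpow B q) (mxpow_adj B q) kerS => S Sh kerS.
have Sx : S *m x != 0 by apply: contraNneq Bx => /kerS ->.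
rewrite -[_ *m gsword _ _ _ *m _ *m _]mulmxA.
have -> : S *m M = (M^t* *m S)^t* by rewrite adjmxM adjmxK Sh.
rewrite qf_conj; apply: IH; last first.
- apply/eqP => /kerS; rewrite -mulmxA => Sy.
  have /negP := completely_invertible_qf (ci M (mem_head _ _)) Sx; apply.
  have : qf (M^t*) (S *m x) = 0.
    by rewrite -qf_conj Sh /qf -!mulmxA Sy mulmx0 mxE.
  by rewrite adj_qf => /eqP; rewrite conjc_eq0.
- exact: mid_letter_cons mid.
- by move=> r rp; apply: pos; rewrite inE rp orbT.
- by move=> N NCs; apply: ci; rewrite inE NCs orbT.
Qed.

Lemma gsword_ker B p Cs x : word_size p Cs -> psd B -> (forall q, q \in p -> 0 < q) ->
  B *m x = 0 -> gsword p Cs B *m x = 0.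
Proof.
move=> sz psdB; move: p Cs sz.
apply: word_size_ind => [q|q M|q q' p M Cs _ _] pos Bx;
  have /(mxpow_ker _ psdB) Sx := Bx;
  have {}Sx : mxpow B q *m x = 0 by [apply: Sx; apply: pos; rewrite mem_head].
- exact: Sx.
- by rewrite gsword1 -mulmxA Sx mulmx0.
by rewrite gsword_cons -mulmxA Sx mulmx0.
Qed.

Lemma mxpow_scale B (k q : R) : psd B -> 0 <= k ->
  mxpow (k%:C *: B) q = (powR k q)%:C *: mxpow B q.
Proof.
move=> [Bh B0] k0; have Vu := spectral_unitarymx B.
rewrite !mxpow_hfun -{1}(herm_spec Bh) specZ hfun_spec // specZ.
by apply: eq_spec => i /=; rewrite powRM.
Qed.

(** The degree [r] is the sum of all exponents along the word, so an exponent that occurs on both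
    sides counts twice. *)
Lemma gsword_scale p Cs : word_size p Cs -> (forall q, q \in p -> 0 < q) ->
  exists2 r : R, 0 < r & forall B (k : R), psd B -> 0 < k ->
  gsword p Cs (k%:C *: B) = (powR k r)%:C *: gsword p Cs B.
Proof.
move=> sz; move: p Cs sz; apply: word_size_ind => [q|q M|q q' p M Cs _ IH] pos.
- by exists q => [|B k psdB k0]; [apply: pos; rewrite mem_head|exact/mxpow_scale/ltW].
- exists (q + q) => [|B k psdB k0]; first by rewrite addr_gt0 // pos ?mem_head.
  rewrite !gsword1 !mxpow_scale ?ltW // -!scalemxAl -!scalemxAr scalerA -rmorphM.
  by rewrite -powRD ?(gt_eqF k0) ?implybT.
have [r|r r0 IHr] := IH; first by move=> rp; apply: pos; rewrite inE rp orbT.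
have q0 : 0 < q by rewrite pos ?mem_head.
exists (q + r + q) => [|B k psdB k0]; first by rewrite !addr_gt0.
rewrite !gsword_cons IHr // !mxpow_scale ?(ltW k0) //.
rewrite -!(scalemxAl, scalemxAr) !scalerA -!rmorphM.
by congr (_%:C *: _); rewrite !powRD ?(gt_eqF k0) ?implybT //; ring.
Qed.

Lemma spec1 V : V \is unitarymx -> spec V (fun=> 1) = 1%:M.
Proof. exact: spec_const. Qed.

Lemma mxpow1 q : mxpow (1%:M : 'M[C]_n) q = 1%:M.
Proof.
have Vu := spectral_unitarymx (1%:M : 'M[C]_n).
rewrite mxpow_hfun -{1}(spec1 Vu) hfun_spec // -[RHS](spec1 Vu).
by apply: eq_spec => i /=; rewrite powR1.
Qed.

(** At the identity all powers disappear; cancelling the invertible outer letters reduces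
    self-adjointness of the word to that of its central letter. *)
Lemma mid_letter_herm p Cs : word_size p Cs -> (forall M, M \in Cs -> M \in unitmx) ->
  (gsword p Cs 1%:M)^t* = gsword p Cs 1%:M -> mid_letter (fun M => M^t* = M) p Cs.
Proof.
move=> sz; move: p Cs sz; apply: word_size_ind => [q|q M|q q' p M Cs sz IH] un.
- by [].
- by rewrite gsword1 !mxpow1 !mulmx1 !mul1mx => Mh _.
rewrite gsword_cons mxpow1 !mulmx1 !mul1mx !adjmxM adjmxK mulmxA.
have Mu : M \in unitmx by apply: un; rewrite mem_head.
have M'u : M^t* \in unitmx by rewrite map_unitmx unitmx_tr.
move=> /(can_inj (mulmxK M'u))/(can_inj (mulKmx Mu)) Wh szp.
have [szp'] := szp; case: Cs sz IH un szp szp' Wh => [//|N Cs] sz IH un szp szp' Wh.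
apply: IH => // K KCs; apply: un; rewrite inE KCs orbT //.
Qed.

(** Complete invertibility makes a Hermitian matrix definite, of either sign; the hypothesis on
    [- M] selects the sign. *)
Lemma herm_ci_posdef M : M^t* = M -> completely_invertible M -> ~ posdef (- M) -> posdef M.
Proof.
move=> Mh ci nneg; have Vu := spectral_unitarymx M.
set V := spectralmx M in Vu; set c := eig M.
have ME : M = spec V c by rewrite herm_spec.
have c0 i : c i != 0.
  have := completely_invertible_qf ci (eigvec_neq0 i Vu).
  by rewrite {1}ME (qf_eigvec _ _ Vu); apply: contra => /eqP ->.
have [i ci0] : exists i, 0 < c i.
  apply: contrapT => /forallNP cn; apply: nneg.
  have -> : - M = spec V (fun i => -1 * c i).
    by rewrite -specZ -ME rmorphN1 scaleN1r.
  apply: posdef_spec => // i; rewrite mulN1r oppr_gt0 lt_neqAle c0 /=.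
  by rewrite leNgt; apply/negP.
rewrite ME; apply: posdef_spec => // j; rewrite ltNge; apply/negP => cj.
have {}cj : c j < 0 by rewrite lt_neqAle c0.
have ij : i != j by apply: contraTneq ci0 => ->; rewrite -leNgt ltW.
(* A combination of eigenvectors for eigenvalues of opposite signs is isotropic. *)
pose x : 'cV[C]_n :=
  V^t* *m ((Num.sqrt (- c j))%:C *: delta_mx i 0 + (Num.sqrt (c i))%:C *: delta_mx j 0).
have Vx : V *m x = (Num.sqrt (- c j))%:C *: delta_mx i 0 + (Num.sqrt (c i))%:C *: delta_mx j 0.
  by rewrite mulmxA (unitarymxP Vu) mul1mx.
have xi : (V *m x) i 0 = (Num.sqrt (- c j))%:C.
  by rewrite Vx !mxE !eqxx (negbTE ij) mulr1 mulr0 addr0.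
have xj : (V *m x) j 0 = (Num.sqrt (c i))%:C.
  by rewrite Vx !mxE !eqxx [j == i]eq_sym (negbTE ij) mulr1 mulr0 add0r.
have xk k : k != i -> k != j -> (V *m x) k 0 = 0.
  by move=> ki kj; rewrite Vx !mxE (negbTE ki) (negbTE kj) !mulr0 addr0.
have x0 : x != 0.
  apply/eqP => x0; move: xi; rewrite x0 mulmx0 mxE => -[/esym/eqP].
  by rewrite sqrtr_eq0 oppr_le0 leNgt cj.
have /negP := completely_invertible_qf ci x0; apply.
rewrite ME qf_spec (bigD1 i) //= (bigD1 j) 1?eq_sym //= big1 => [|k /andP[ki kj]].
  rewrite xi xj !normsqR !sqr_sqrtr ?oppr_ge0 ?ltW // addr0.
  by apply/eqP; congr (_%:C); ring.
by rewrite xk // /normsq /= expr0n addr0 mulr0.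
Qed.

End Forms.

(** * Continuity of the spectral calculus *)

Section Continuity.
Variables (R : realType) (T : topologicalType).
Local Notation C := R[i].

Lemma fcontD (f g : T -> R) : continuous f -> continuous g -> continuous (fun x => f x + g x).
Proof. by move=> cf cg x; apply: (@cvgD _ _ _ (nbhs x)); [exact: cf|exact: cg]. Qed.

Lemma fcontB (f g : T -> R) : continuous f -> continuous g -> continuous (fun x => f x - g x).
Proof. by move=> cf cg x; apply: (@cvgB _ _ _ (nbhs x)); [exact: cf|exact: cg]. Qed.

Lemma fcontM (f g : T -> R) : continuous f -> continuous g -> continuous (fun x => f x * g x).
Proof. by move=> cf cg x; apply: (@cvgM _ _ (nbhs x)); [exact: cf|exact: cg]. Qed.

Lemma fcont_sum (I : finType) (f : I -> T -> R) :
  (forall i, continuous (f i)) -> continuous (fun x => \sum_i f i x).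
Proof. by move=> cf; apply: continuous_big => //; exact: add_continuous. Qed.

(* Entrywise continuity, so that no topology on R[i] is needed. *)
Definition mxcont m n (F : T -> 'M[C]_(m, n)) := forall i j,
  continuous (fun x => complex.Re (F x i j)) /\ continuous (fun x => complex.Im (F x i j)).

Lemma mxcont_cst m n (A : 'M[C]_(m, n)) : mxcont (fun=> A).
Proof. by move=> i j; split; exact: cst_continuous. Qed.

Lemma Re_sum (I : finType) (F : I -> C) : complex.Re (\sum_i F i) = \sum_i complex.Re (F i).
Proof. by apply: (big_morph (@complex.Re R)) => [[a b] [c d]|]. Qed.

Lemma Im_sum (I : finType) (F : I -> C) : complex.Im (\sum_i F i) = \sum_i complex.Im (F i).
Proof. by apply: (big_morph (@complex.Im R)) => [[a b] [c d]|]. Qed.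

Lemma mxcontM m n q (F : T -> 'M[C]_(m, n)) (G : T -> 'M[C]_(n, q)) :
  mxcont F -> mxcont G -> mxcont (fun x => F x *m G x).
Proof.
move=> cF cG i j; split.
  rewrite (_ : (fun x => _) = (fun x => \sum_k
    (complex.Re (F x i k) * complex.Re (G x k j) - complex.Im (F x i k) * complex.Im (G x k j)))).
    by apply: fcont_sum => k; apply: fcontB; apply: fcontM;
      [exact: (cF i k).1|exact: (cG k j).1|exact: (cF i k).2|exact: (cG k j).2].
  apply/funext => x; rewrite mxE Re_sum; apply: eq_bigr => k _.
  by case: (F x i k) => a b; case: (G x k j).
rewrite (_ : (fun x => _) = (fun x => \sum_k
  (complex.Re (F x i k) * complex.Im (G x k j) + complex.Im (F x i k) * complex.Re (G x k j)))).
  by apply: fcont_sum => k; apply: fcontD; apply: fcontM;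
    [exact: (cF i k).1|exact: (cG k j).2|exact: (cF i k).2|exact: (cG k j).1].
apply/funext => x; rewrite mxE Im_sum; apply: eq_bigr => k _.
by case: (F x i k) => a b; case: (G x k j).
Qed.

Lemma mxcontB m n (F G : T -> 'M[C]_(m, n)) :
  mxcont F -> mxcont G -> mxcont (fun x => F x - G x).
Proof.
move=> cF cG i j; split.
  rewrite (_ : (fun x => _) = (fun x => complex.Re (F x i j) - complex.Re (G x i j))).
    exact: fcontB (cF i j).1 (cG i j).1.
  by apply/funext => x; rewrite !mxE; case: (F x i j) => a b; case: (G x i j).
rewrite (_ : (fun x => _) = (fun x => complex.Im (F x i j) - complex.Im (G x i j))).
  exact: fcontB (cF i j).2 (cG i j).2.
by apply/funext => x; rewrite !mxE; case: (F x i j) => a b; case: (G x i j).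
Qed.

Lemma mxcont_tr n (F : T -> 'M[C]_n) :
  mxcont F -> continuous (fun x => complex.Re (\tr (F x))).
Proof.
move=> cF; rewrite (_ : (fun x => _) = (fun x => \sum_i complex.Re (F x i i))).
  by apply: fcont_sum => i; exact: (cF i i).1.
by apply/funext => x; rewrite Re_sum.
Qed.

Lemma mxcont_frob2 m n (F : T -> 'M[C]_(m, n)) : mxcont F -> continuous (fun x => frob2 (F x)).
Proof.
move=> cF; apply: fcont_sum => i; apply: fcont_sum => j.
by apply: fcontD; apply: fcontM;
  [exact: (cF i j).1|exact: (cF i j).1|exact: (cF i j).2|exact: (cF i j).2].
Qed.

Lemma mxcont_near m n (F : T -> 'M[C]_(m, n)) x0 (e : R) : mxcont F -> 0 < e ->
  \forall x \near x0, frob2 (F x - F x0) < e.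
Proof.
move=> cF e0; have /mxcont_frob2/(_ x0) h := mxcontB cF (mxcont_cst (F x0)).
apply: (cvgr_lt _ h); rewrite subrr; suff -> : frob2 (0 : 'M[C]_(m, n)) = 0 by [].
by rewrite /frob2 big1 // => i _; rewrite big1 // => j _; rewrite mxE /normsq /= expr0n addr0.
Qed.

Lemma near_mxcont m n (F : T -> 'M[C]_(m, n)) :
  (forall x0 (e : R), 0 < e -> \forall x \near x0, frob2 (F x - F x0) < e) -> mxcont F.
Proof.
move=> nF i j.
have sqr_lt (a e : R) : 0 < e -> a ^+ 2 < e ^+ 2 -> `|a| < e.
  move=> e0; rewrite -(real_normK (num_real a)) ltr_pXn2r ?nnegrE ?normr_ge0 //.
  exact: ltW.
split=> x0; apply/cvgrPdist_lt => e e0; apply: filterS (nF x0 (e ^+ 2) _) => [x|].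
- move=> /(le_lt_trans (normsq_le_frob2 _ i j)); rewrite !mxE => h; apply: sqr_lt => //.
  apply: le_lt_trans h; case: (F x i j) => a b; case: (F x0 i j) => c d.
  by rewrite /normsq /= -sqrrN opprB lerDl sqr_ge0.
- by rewrite exprn_gt0.
- move=> /(le_lt_trans (normsq_le_frob2 _ i j)); rewrite !mxE => h; apply: sqr_lt => //.
  apply: le_lt_trans h; case: (F x i j) => a b; case: (F x0 i j) => c d.
  by rewrite /normsq /= -sqrrN opprB lerDr sqr_ge0.
by rewrite exprn_gt0.
Qed.

(** The bound covers every [b] in [D], not only those near [a], because [frob2_hfunB] compares each
    eigenvalue of one matrix with all eigenvalues of the other. The additive [eps] admits functions
    that are not Lipschitz, such as [powR] with exponent below 1 at 0. *)
Definition modulus_on (D : set R) (g : R -> R) := forall a (eps : R), D a -> 0 < eps ->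
  exists2 L : R, 0 <= L & forall b, D b -> `|g b - g a| <= eps + L * `|b - a|.

Lemma mxcont_hfun n (D : set R) (g : R -> R) (F : T -> 'M[C]_n) :
  modulus_on D g -> (forall x, (F x)^t* = F x) -> (forall x i, D (eig (F x) i)) ->
  mxcont F -> mxcont (fun x => hfun g (F x)).
Proof.
move=> mg Fh FD cF; apply: near_mxcont => x0 e e0.
(* Chosen to make [2 * eps ^+ 2 * n%:R] less than [e / 2]; the successor keeps the denominator
   nonzero when [n = 0]. *)
pose eps := Num.sqrt (e / (4 * n.+1%:R)).
have n0 : 0 < n.+1%:R :> R by rewrite ltr0n.
have eps0 : 0 < eps by rewrite sqrtr_gt0 divr_gt0 // mulr_gt0.
have /choice[L LP] : forall j, exists L : R, 0 <= L /\ forall b, D b ->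
    `|g b - g (eig (F x0) j)| <= eps + L * `|b - eig (F x0) j|.
  by move=> j; have [L L0 LP] := mg _ _ (FD x0 j) eps0; exists L.
(* One slope that serves all eigenvalues of [F x0]; the second half of [e] then pays for the term
   with [K ^+ 2]. *)
pose K := \sum_j L j; have K0 : 0 <= K by apply: sumr_ge0 => j _; have [] := LP j.
have K1 : 0 < 4 * (K ^+ 2 + 1) by rewrite mulr_gt0 // ltr_wpDl ?sqr_ge0.
apply: filterS (mxcont_near x0 cF (divr_gt0 e0 K1)) => x xe.
apply: le_lt_trans (frob2_hfunB (Fh x) (Fh x0) (ltW eps0) K0 _) _ => [i j|].
  have [_ LPj] := LP j; apply: le_trans (LPj _ (FD x i)) _.
  rewrite lerD2l ler_wpM2r // /K (bigD1 j) //= lerDl.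
  by apply: sumr_ge0 => k _; have [] := LP k.
rewrite sqr_sqrtr; last by rewrite divr_ge0 ?ltW // mulr_gt0.
rewrite ltr_pdivlMr // in xe.
have : 2 * (e / (4 * n.+1%:R)) * n%:R < e / 2.
  have -> : 2 * (e / (4 * n.+1%:R)) * n%:R = e / 2 * (n%:R / n.+1%:R).
    by move: n.+1%:R n0 => N N0; field; exact: lt0r_neq0.
  by rewrite gtr_pMr ?divr_gt0 // ltr_pdivrMr // mul1r ltr_nat.
have := frob2_ge0 (F x - F x0); move: (frob2 _) xe => z; rewrite mulrA.
by move: (_ * n%:R) (K ^+ 2) => u v; lra.
Qed.

End Continuity.

(** * Moduli of continuity of truncation and of real powers *)

Section Moduli.
Variable R : realType.

Definition clamp (a : R) : R := Num.max 0 (Num.min a 1).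

Lemma clamp_itv a : 0 <= clamp a <= 1.
Proof. by rewrite /clamp /Num.max /Num.min; case: (ltP a 1) => ?; case: ltP => ?; lra. Qed.

Lemma clamp_modulus : modulus_on setT clamp.
Proof.
move=> a eps _ e0; exists 1 => // b _; rewrite mul1r.
suff : `|clamp b - clamp a| <= `|b - a| by move=> /le_trans; apply; rewrite lerDr ltW.
rewrite /clamp /Num.max /Num.min ler_norml.
have := ler_norm (b - a); have := ler_norm (- (b - a)); rewrite normrN.
move: `|b - a| => z.
by case: (ltP a 1) => ?; case: (ltP b 1) => ?; case: ltP => ?; case: ltP => ? ? ?;
  apply/andP; split; lra.
Qed.

Lemma powR_modulus (r : R) : 0 < r -> modulus_on [set a | 0 <= a <= 1] (fun a => powR a r).
Proof.
move=> r0 a eps /= /andP[a0 a1] e0.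
have pw01 b : 0 <= b <= 1 -> 0 <= powR b r <= 1.
  move=> /andP[b0 b1]; rewrite powR_ge0 /=.
  have e1 : powR 1 r = 1 by rewrite powR1.
  by rewrite -[leRHS]e1 ge0_ler_powR ?nnegrE // ltW.
suff [d d0 dP] : exists2 d : R, 0 < d &
    forall b, 0 <= b <= 1 -> `|b - a| < d -> `|powR b r - powR a r| <= eps.
  (* Beyond distance [d] the linear term exceeds 1, while powers of points of [0, 1] differ by at
     most 1. *)
  exists d^-1 => [|b b01]; first by rewrite invr_ge0 ltW.
  have [bd|bd] := ltP `|b - a| d.
    by rewrite (le_trans (dP _ b01 bd)) // lerDl mulr_ge0 // invr_ge0 ltW.
  rewrite (@le_trans _ _ 1) //; last first.
    by rewrite -[leLHS]add0r lerD ?(ltW e0) // mulrC ler_pdivlMr // mul1r.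
  have a01 : 0 <= a <= 1 by rewrite a0.
  have := pw01 a a01; have := pw01 b b01; rewrite ler_norml.
  by move: (powR a r) (powR b r) => u v; lra.
move: a0; rewrite le_eqVlt => /orP[/eqP a0|a0].
  (* At 0 differentiability may fail, and the radius is found by solving [d^r = eps]. *)
  exists (powR eps r^-1); first by rewrite powR_gt0.
  move=> b /andP[b0 b1]; rewrite -a0 subr0 powR0 ?gt_eqF // subr0.
  rewrite !ger0_norm ?powR_ge0 // => be.
  have -> : eps = powR (powR eps r^-1) r.
    by rewrite -powRrM mulVf ?gt_eqF // powRr1 // ltW.
  by rewrite ge0_ler_powR ?nnegrE ?powR_ge0 // ltW.
have /differentiable_continuous : differentiable (fun x : R => powR x r) a.
  by apply/derivable1_diffP; apply: derivable_powR; rewrite in_itv /= a0.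
move=> /cvgrPdist_le/(_ eps e0)/nbhs_ballP[d /= d0 dP]; exists d => // b _ bd.
by rewrite distrC; apply: dP; rewrite /ball /= distrC.
Qed.

End Moduli.

(** * The fixed point equation *)

Section BoxExtrema.
Variables (R : realType) (N : nat) (b : R) (f : 'rV[R]_N -> R).
Hypotheses (b0 : 0 <= b) (cf : continuous f).

Lemma box_neq0 : [set x : 'rV[R]_N | forall i, `|x 0 i| <= b] !=set0.
Proof. by exists 0 => i; rewrite mxE normr0. Qed.

Lemma box_upper : exists M : R, forall x : 'rV[R]_N, (forall i, `|x 0 i| <= b) -> f x <= M.
Proof.
have [c _ cP] := EVT_max_rV box_neq0 (@box_compact R N b) (continuous_subspaceT cf).
by exists (f c) => x xb; apply: cP; rewrite inE.
Qed.

Lemma box_lower_gt0 : (forall x, 0 < f x) ->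
  exists2 c : R, 0 < c & forall x : 'rV[R]_N, (forall i, `|x 0 i| <= b) -> c <= f x.
Proof.
move=> f0; have [c _ cP] :=
  EVT_min_rV box_neq0 (@box_compact R N b) (continuous_subspaceT cf).
by exists (f c) => // x xb; apply: cP; rewrite inE.
Qed.

End BoxExtrema.

Section HermitianCoordinates.
Variables (R : realType) (n : nat).
Local Notation C := R[i].

(* A Hermitian matrix is determined by the real matrix Re A + Im A, of which
   Re A and Im A are the symmetric and antisymmetric parts. *)
Definition herm_of (v : 'rV[R]_(n * n)) : 'M[C]_n := \matrix_(i, j)
  Complex ((vec_mx v i j + vec_mx v j i) / 2) ((vec_mx v i j - vec_mx v j i) / 2).

Definition coords_of (A : 'M[C]_n) : 'rV[R]_(n * n) :=
  mxvec (\matrix_(i, j) (complex.Re (A i j) + complex.Im (A i j))).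

Lemma herm_of_adj v : (herm_of v)^t* = herm_of v.
Proof.
apply/matrixP => i j; rewrite !mxE; apply/eqP; rewrite eq_complex /=.
by apply/andP; split; apply/eqP; ring.
Qed.

Lemma coords_ofK A : A^t* = A -> herm_of (coords_of A) = A.
Proof.
move=> Ah; rewrite /herm_of /coords_of mxvecK; apply/matrixP => i j; rewrite !mxE.
have := congr1 (fun M : 'M[C]_n => M j i) Ah; rewrite !mxE.
case: (A i j) => a b; case: (A j i) => c d [<- <-].
by apply/eqP; rewrite eq_complex /=; apply/andP; split; apply/eqP; field.
Qed.

Lemma herm_of_cont : mxcont herm_of.
Proof.
have cv i j : continuous (fun v : 'rV[R]_(n * n) => vec_mx v i j).
  rewrite (_ : (fun v => _) = (fun v : 'rV[R]_(n * n) => v 0 (mxvec_index i j))).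
    exact: coord_continuous.
  by apply/funext => v; rewrite mxE.
move=> i j; split.
  rewrite (_ : (fun v => _) = (fun v : 'rV[R]_(n * n) =>
    (vec_mx v i j + vec_mx v j i) * 2^-1)); last by apply/funext => v; rewrite mxE.
  by apply: fcontM; [exact: fcontD|exact: cst_continuous].
rewrite (_ : (fun v => _) = (fun v : 'rV[R]_(n * n) =>
  (vec_mx v i j - vec_mx v j i) * 2^-1)); last by apply/funext => v; rewrite mxE.
by apply: fcontM; [exact: fcontB|exact: cst_continuous].
Qed.

Lemma coords_of_cont (T : topologicalType) (F : T -> 'M[C]_n) k :
  mxcont F -> continuous (fun x => coords_of (F x) 0 k).
Proof.
move=> cF; case/mxvec_indexP: k => i j.
rewrite (_ : (fun x => _) = (fun x => complex.Re (F x i j) + complex.Im (F x i j))).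
  exact: fcontD (cF i j).1 (cF i j).2.
by apply/funext => x; rewrite mxvecE mxE.
Qed.

Lemma coords_ofB A B : coords_of (A - B) = coords_of A - coords_of B.
Proof.
rewrite /coords_of -linearB; congr mxvec; apply/matrixP => i j; rewrite !mxE.
by case: (A i j) => a b; case: (B i j) => c d /=; ring.
Qed.

Lemma coords_ofZ (a : R) A : coords_of (a%:C *: A) = a *: coords_of A.
Proof.
rewrite /coords_of -linearZ; congr mxvec; apply/matrixP => i j; rewrite !mxE.
by case: (A i j) => b c /=; ring.
Qed.

(** A crude consequence of [2 |a| <= a^2 + 1], used for both parts of an entry; the existence of an
    index gives [n >= 1]. *)
Lemma coords_of_bound A k : frob2 A <= n%:R -> `|coords_of A 0 k| <= 2 * n%:R.
Proof.
move=> An; case/mxvec_indexP: k => i j; rewrite mxvecE mxE.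
have n1 : 1 <= n%:R :> R by rewrite ler1n (leq_ltn_trans _ (ltn_ord i)).
have := le_trans (normsq_le_frob2 A i j) An; rewrite /normsq.
case: (A i j) => a b /=; move: (n%:R) n1 => N N1 ab.
have := sqr_ge0 (a - 1); have := sqr_ge0 (b - 1).
have := sqr_ge0 (a + 1); have := sqr_ge0 (b + 1).
by rewrite ler_norml => *; apply/andP; split; lra.
Qed.

End HermitianCoordinates.

Lemma mxcont_gsword (R : realType) (n : nat) (T : topologicalType) (F : T -> 'M[R[i]]_n)
    p Cs : word_size p Cs -> (forall q, q \in p -> 0 < q) ->
  (forall x, (F x)^t* = F x) -> (forall x i, 0 <= eig (F x) i <= 1) -> mxcont F ->
  mxcont (fun x => gsword p Cs (F x)).
Proof.
move=> sz pos Fh F01 cF.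
have cpow q : 0 < q -> mxcont (fun x => mxpow (F x) q).
  move=> q0; rewrite (_ : (fun x => _) = (fun x => hfun (fun a => powR a q) (F x))).
    exact: (mxcont_hfun (powR_modulus q0) Fh).
  by apply/funext => x; rewrite mxpow_hfun.
move: p Cs sz pos; apply: word_size_ind => [q|q M|q q' p M Cs _ IH] pos.
- by apply: cpow; apply: pos; rewrite mem_head.
- have cq : mxcont (fun x => mxpow (F x) q) by apply: cpow; rewrite pos ?mem_head.
  exact: mxcontM (mxcontM cq (mxcont_cst _ M)) cq.
have cq : mxcont (fun x => mxpow (F x) q) by apply: cpow; rewrite pos ?mem_head.
have cW : mxcont (fun x => gsword (q' :: p) Cs (F x)).
  by apply: IH => r rp; apply: pos; rewrite inE rp orbT.
exact: mxcontM (mxcontM (mxcontM (mxcontM cq (mxcont_cst _ M)) cW) (mxcont_cst _ _)) cq.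
Qed.

(** * Solution up to a scalar factor *)

Section Solution.
Variables (R : realType) (n : nat).
Local Notation C := R[i].

Lemma ReM (a : R) (z : C) : complex.Re (a%:C * z) = a * complex.Re z.
Proof. by case: z => x y /=; rewrite mul0r subr0. Qed.

Lemma ReB (z w : C) : complex.Re (z - w) = complex.Re z - complex.Re w.
Proof. by case: z => a b; case: w. Qed.

Lemma Re_gt0 (z : C) : 0 < z -> 0 < complex.Re z.
Proof. by rewrite ltcE => /andP[]. Qed.

Lemma adjmxB (A B : 'M[C]_n) : (A - B)^t* = A^t* - B^t*.
Proof. by apply/matrixP => i j; rewrite !mxE rmorphB. Qed.

Lemma adjmxZr (a : R) (A : 'M[C]_n) : (a%:C *: A)^t* = a%:C *: A^t*.
Proof.
by apply/matrixP => i j; rewrite !mxE rmorphM; congr (_ * _); exact: conjc_real.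
Qed.

Lemma frob2_spec (V : 'M[C]_n) d : V \is unitarymx -> frob2 (spec V d) = \sum_i d i ^+ 2.
Proof.
move=> Vu; have V'u : V^t* \is unitarymx by rewrite trmxC_unitary.
rewrite /spec (frob2_unitaryr _ Vu) (frob2_unitaryl _ V'u).
apply: eq_bigr => i _; rewrite (bigD1 i) //= big1 => [|j ji].
  by rewrite !mxE eqxx mulr1n normsqR addr0.
by rewrite mxE eq_sym (negbTE ji) mulr0n /normsq /= expr0n addr0.
Qed.

Lemma spec_traceM (V : 'M[C]_n) d e : V \is unitarymx ->
  complex.Re (\tr (spec V d *m spec V e)) = \sum_i d i * e i.
Proof.
move=> Vu; rewrite spec_trace Re_sum; apply: eq_bigr => i _.
by rewrite ReM (qf_eigvec _ _ Vu).
Qed.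

Lemma gsword_scaled_solution (p : seq R) (Cs : seq 'M[C]_n) (P : 'M[C]_n) :
  word_size p Cs -> (forall M, M \in Cs -> completely_invertible M) ->
  (forall q, q \in p -> 0 < q) -> mid_letter (fun M => M^t* = M) p Cs ->
  mid_letter (@posdef R n) p Cs -> posdef P ->
  exists (tau : R) (B : 'M[C]_n),
    [/\ 0 < tau, psd B, posdef B & gsword p Cs B = tau%:C *: P].
Proof.
move=> sz ci pos midH midP [Ph Ppos].
pose H := @herm_of R n; pose V v := spectralmx (H v); pose h v := eig (H v).
have Vu v : V v \is unitarymx by exact: spectral_unitarymx.
have HE v : H v = spec (V v) (h v) by exact/esym/herm_spec/herm_of_adj.
pose B v := hfun (@clamp R) (H v).
have BE v : B v = spec (V v) (@clamp R \o h v) by [].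
have cl0 v i : 0 <= clamp (h v i) by have /andP[] := clamp_itv (h v i).
have psdB v : psd (B v) by apply: (psd_spec (Vu v)) => i; exact: cl0.
have B01 v i : 0 <= eig (B v) i <= 1.
  by have [j ->] := eig_spec (@clamp R \o h v) i (Vu v); exact: clamp_itv.
have cB : mxcont B.
  apply: (mxcont_hfun (@clamp_modulus R)) => //; first exact: herm_of_adj.
  exact: herm_of_cont.
pose W v := gsword p Cs (B v).
have cW : mxcont W by apply: mxcont_gsword => // v; have [] := psdB v.
have Wh v : (W v)^t* = W v by exact: gsword_herm.
have B_eig0 v i : clamp (h v i) = 0 -> B v *m eigvec (V v) i = 0.
  move=> e; apply/(spec_ker _ _ (Vu v)) => k.
  have [->|ki] := eqVneq k i; [by left|right].
  by rewrite (mul_eigvec _ (Vu v)) mxE (negbTE ki).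
have B_eig v i : 0 < clamp (h v i) -> B v *m eigvec (V v) i != 0.
  move=> e; apply/eqP => /(spec_ker _ _ (Vu v))/(_ i)[/= e0|].
    by rewrite e0 ltxx in e.
  by rewrite (mul_eigvec _ (Vu v)) mxE !eqxx => /eqP; rewrite oner_eq0.
have W_eig v i : 0 < clamp (h v i) -> 0 < complex.Re (qf (W v) (eigvec (V v) i)).
  by move=> e; apply/Re_gt0/gsword_qf_gt0 => //; exact: B_eig.
have W_eig0 v i : clamp (h v i) = 0 -> qf (W v) (eigvec (V v) i) = 0.
  by move=> /B_eig0 e; rewrite /qf -mulmxA (gsword_ker sz (psdB v) pos e) mulmx0 mxE.
pose phi v := complex.Re (\tr (B v *m W v)).
have phiE v : phi v = \sum_i clamp (h v i) * complex.Re (qf (W v) (eigvec (V v) i)).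
  by rewrite /phi BE spec_trace Re_sum; apply: eq_bigr => i _; rewrite ReM.
have phi_term v i : 0 <= clamp (h v i) * complex.Re (qf (W v) (eigvec (V v) i)).
  have := cl0 v i; rewrite le_eqVlt => /orP[/eqP <-|e]; first by rewrite mul0r.
  by rewrite mulr_ge0 ?ltW // W_eig.
pose u v := 1 - complex.Re (\tr (B v)).
have trBE v : complex.Re (\tr (B v)) = \sum_i clamp (h v i).
  rewrite -[B v]mulmx1 -(spec1 (Vu v)) BE (spec_traceM _ _ (Vu v)).
  by apply: eq_bigr => i _; rewrite mulr1.
have cphi : continuous phi by exact: mxcont_tr (mxcontM cB cW).
have cu : continuous u by apply: fcontB; [exact: cst_continuous|exact: mxcont_tr].
(* The added term is positive when the trace of [B v] is below 1 and vanishes otherwise. So [psi] is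
   positive on the whole box, even where [phi] vanishes, and equals [phi] as soon as [B v] has an
   eigenvalue 1. *)
pose psi v := phi v + (u v + `|u v|).
have cpsi : continuous psi.
  apply: fcontD => //; apply: fcontD => // v.
  by apply: (cvg_norm (F := nbhs v)); exact: cu.
have psi0 v : 0 < psi v.
  have u2 : 0 <= u v + `|u v| by rewrite -lerBlDl sub0r -normrN ler_norm.
  have phi0 : 0 <= phi v by rewrite phiE sumr_ge0 // => i _; exact: phi_term.
  have [u0|u0] := ltP 0 (u v).
    by rewrite /psi ltr_wpDl // ltr_wpDr // normr_ge0.
  rewrite /psi ltr_wpDr // phiE lt_neqAle -phiE phi0 andbT; apply/eqP => e.
  have cl i : clamp (h v i) = 0.
    apply: contrapT => /eqP ne; have {}ne : 0 < clamp (h v i) by rewrite lt_neqAle eq_sym ne cl0.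
    have : phi v > 0.
      rewrite phiE (bigD1 i) //= ltr_pwDl ?mulr_gt0 ?W_eig //.
      by rewrite sumr_ge0 // => j _; exact: phi_term.
    by rewrite -e ltxx.
  by move: u0; rewrite /u trBE big1 // subr0 ler10.
(* The first summand bounds the coordinates of [B v] by [coords_of_bound]; the 1 leaves room for the
   correction [s * coords_of (G v) 0 k]. *)
pose b : R := 2 * n%:R + 1.
have b0 : 0 < b by rewrite ltr_wpDl // mulr_ge0.
have [c c0 cP] := box_lower_gt0 (ltW b0) cpsi psi0.
pose mu v := complex.Re (\tr (B v *m P)).
have cmu : continuous mu by exact: mxcont_tr (mxcontM cB (mxcont_cst _ P)).
have [K KP] := box_upper (ltW b0) cmu.
have K0 : 0 < `|K| + 1 by rewrite ltr_wpDl.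
(* This keeps [tau * mu v] at most [c / 2] on the box, short of the lower bound [c] for [psi]. *)
pose tau := c / (2 * (`|K| + 1)).
have tau0 : 0 < tau by rewrite divr_gt0 // mulr_gt0.
have tauK : tau * (`|K| + 1) = c / 2.
  by rewrite /tau; move: (`|K| + 1) K0 => k k0; field; exact: lt0r_neq0.
pose G v := W v - tau%:C *: P.
have cG : mxcont G by exact: mxcontB cW (mxcont_cst _ _).
have cg k : continuous (fun v => coords_of (G v) 0 k) by exact: coords_of_cont.
have [M MP] := box_upper (ltW b0)
  (fcont_sum (fun k => fcontM (cg k) (cg k))).
have M0 : 0 < `|M| + 1 by rewrite ltr_wpDl.
(* On the box [M] bounds the sum of the squared coordinates of [G v], so each coordinate is at most
   [|M| + 1] in modulus and its multiple by [s] at most 1. *)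
pose s := (`|M| + 1)^-1; have s0 : 0 < s by rewrite invr_gt0.
pose f k v := coords_of (B v) 0 k - s * coords_of (G v) 0 k.
have [|v vb|v vb vf] := @Brouwer_box R (n * n) b f b0.
- move=> k; apply: fcontB; first exact: coords_of_cont.
  by apply: fcontM => //; exact: cst_continuous.
- move=> k; apply: le_trans (ler_normB _ _) _; rewrite lerD //.
    apply: coords_of_bound; rewrite BE (frob2_spec _ (Vu v)).
    rewrite -[n in n%:R]card_ord -sum1_card natr_sum; apply: ler_sum => i _.
    by have /andP[? ?] := clamp_itv (h v i); rewrite exprn_ile1.
  rewrite normrM gtr0_norm // /s mulrC ler_pdivrMr // mul1r.
  have : coords_of (G v) 0 k * coords_of (G v) 0 k <= `|M|.
    apply: le_trans (ler_norm M); apply: le_trans (MP v vb).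
    by rewrite (bigD1 k) //= lerDl sumr_ge0 // => j _; rewrite -expr2 sqr_ge0.
  move: (coords_of _ _ _) => x; rewrite -expr2 -(real_normK (num_real x)).
  move: `|x| (normr_ge0 x) => y y0 yM; have := sqr_ge0 (y - 1); nra.
(* The fixed point gives equality of coordinates, which determine both sides because both are
   Hermitian. *)
have HBG : H v = B v - s%:C *: G v.
  rewrite -[RHS]coords_ofK.
    congr herm_of; apply/rowP => k.
    by rewrite -vf coords_ofB coords_ofZ !mxE.
  have [Bh _] := psdB v.
  by rewrite adjmxB adjmxZr Bh adjmxB adjmxZr Ph Wh.
have GE : s%:C *: G v = B v - H v by rewrite HBG opprB addrC subrK.
have trBG : complex.Re (\tr (B v *m (s%:C *: G v))) = s * (phi v - tau * mu v).
  rewrite /G -scalemxAr mulmxBr -scalemxAr.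
  by rewrite mxtraceZ ReM raddfB ReB /= mxtraceZ ReM.
have BG0 : phi v <= tau * mu v.
  rewrite -subr_le0 -(pmulr_rle0 _ s0) -trBG GE HE BE specB (spec_traceM _ _ (Vu v)).
  rewrite -oppr_ge0 -sumrN sumr_ge0 // => i _ /=; rewrite -mulrN opprB /clamp.
  (* With [a = h v i], the product [clamp a * (a - clamp a)] is 0 for [a <= 1] and [a - 1]
     beyond. *)
  by rewrite /Num.max /Num.min; case: (ltP (h v i) 1) => ?; case: ltP => ?; nra.
have h_lt1 i : h v i < 1.
  rewrite ltNge; apply/negP => h1.
  have cl1 : clamp (h v i) = 1.
    by rewrite /clamp (min_idPr h1) (max_idPr ler01).
  have u0 : u v <= 0.
    rewrite /u trBE (bigD1 i) //= cl1 opprD addrA subrr sub0r oppr_le0.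
    by rewrite sumr_ge0.
  have := cP v vb; rewrite /psi (ler0_norm u0) subrr addr0 => cphi_v.
  have : mu v <= `|K| + 1 by rewrite (le_trans (KP v vb)) // (le_trans (ler_norm K)) // lerDl.
  rewrite -(ler_pM2l tau0) => /(le_trans BG0)/(le_trans cphi_v).
  by rewrite tauK; lra.
have h_gt0 i : 0 < h v i.
  rewrite ltNge; apply/negP => h0.
  have cl0i : clamp (h v i) = 0.
    by rewrite /clamp (min_idPl (ltW (h_lt1 i))) (max_idPl h0).
  have := congr1 (fun A => complex.Re (qf A (eigvec (V v) i))) GE.
  rewrite HE BE specB (qf_eigvec _ _ (Vu v)) qfZ ReM qfB qfZ ReB ReM W_eig0 //=.
  rewrite cl0i !sub0r => e.
  have := Re_gt0 (Ppos _ (eigvec_neq0 i (Vu v))); rewrite -/(qf _ _).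
  move: (complex.Re (qf P _)) e => x e x0.
  have : 0 < s * (tau * x) by exact: mulr_gt0 s0 (mulr_gt0 tau0 x0).
  by rewrite -oppr_lt0 -mulrN e oppr_lt0 ltNge h0.
have clh i : clamp (h v i) = h v i.
  by rewrite /clamp (min_idPl (ltW (h_lt1 i))) (max_idPr (ltW (h_gt0 i))).
have BH : B v = H v by rewrite BE HE; exact: eq_spec.
exists tau, (B v); split => //.
  by rewrite BH HE; exact: posdef_spec (Vu v) h_gt0.
have : s%:C *: G v = 0 by rewrite GE BH subrr.
move=> /eqP; rewrite scaler_eq0 => /orP[/eqP[] s00|]; first by rewrite s00 ltxx in s0.
by rewrite subr_eq0 => /eqP.
Qed.

End Solution.

Theorem theorem7p1 (R : realType) (n m : nat)
    (C : m.-tuple 'M[R[i]]_n) (p : seq R)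
    (C_ci : forall Ci, Ci \in C -> completely_invertible Ci)
    (W_gsw : generalized_symmetric_word p C)
    (p_gt0 : forall q, q \in p -> 0 < q)
    (* vacuous when the middle of the word is a power of A; if the middle is C_m
       itself and C_m = -1, then W(A) is negative definite *)
    (mid : size p = m -> ~ posdef (- last 0 C))
    (P : 'M[R[i]]_n) (P_pd : posdef P) :
  exists A : 'M[R[i]]_n, posdef A /\ gsword p C A = P.
Proof.
have [sz un adj] := W_gsw.
have u1 : (1%:M : 'M[R[i]]_n) \is unitarymx.
  by apply/unitarymxP; rewrite trmx1 map_mx1 mulmx1.
have pd1 : posdef (1%:M : 'M[R[i]]_n).
  by rewrite -(spec1 u1); apply: (posdef_spec u1) => i; exact: ltr01.
have midH := mid_letter_herm sz un (adj _ pd1).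
have midP : mid_letter (@posdef R n) p C.
  move=> szp; apply: (herm_ci_posdef (midH szp)).
    apply: C_ci; case: sz => [|[_]]; first by rewrite szp => /n_Sn.
    rewrite -[last 0 C \in C]/(last 0 (tval C) \in tval C).
    by case: (tval C) => // M Cs _; exact: (mem_last M Cs).
  by apply: mid; rewrite szp size_tuple.
have [tau [B [tau0 psdB [Bh Bpos] WB]]] :=
  gsword_scaled_solution sz C_ci p_gt0 midH midP P_pd.
have [r r0 Wscale] := gsword_scale sz p_gt0.
(* Chosen so that [k^r] is the inverse of [tau], where [r] is the degree of the word. *)
pose k := powR tau (- r^-1); have k0 : 0 < k by exact: powR_gt0.
exists (k%:C *: B); split.
  split; first by rewrite adjmxZr Bh.
  move=> x x0; rewrite -/(qf _ _) qfZ mulr_gt0 ?ltcR //; exact: Bpos.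
rewrite Wscale // WB scalerA -rmorphM /k -powRrM mulNr mulVf ?gt_eqF //.
by rewrite powRN powRr1 ?(ltW tau0) // mulVf ?gt_eqF // scale1r.
Qed.
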